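(* Let $W$ be a finite Weyl group, let $W'$ be a parabolic subgroup of $W$, and let $w'_0$ be the longest element of $W'$. Then $\mathbf{H}\underline{H}_{w'_0}=\mathbf{LM}_{w'_0}$, where $\mathbf{H}\underline{H}_{w'_0}$ is the left ideal of the Hecke algebra $\mathbf{H}$ of $W$ generated by the Kazhdan-Lusztig basis element $\underline{H}_{w'_0}$, and $\mathbf{LM}_{w'_0}$ is the $\mathbb{Z}[v,v^{-1}]$-span of all $\underline{H}_u$ with $u\geq_L w'_0$.
   Context: Let $W$ be a finite Weyl group with set $S$ of simple reflections and identity $e$. A parabolic subgroup of $W$ is a subgroup generated by a subset of $S$. Put $\mathbb{A}=\mathbb{Z}[v,v^{-1}]$. The Hecke algebra $\mathbf{H}$ of $W$ is the $\mathbb{A}$-algebra generated by $H_s$, $s\in S$, subject to the braid relations of $(W,S)$ and $H_s^2=H_e+(v^{-1}-v)H_s$; it has the standard $\mathbb{A}$-basis $\{H_w : w\in W\}$, where $H_w=H_{s_1}\cdots H_{s_k}$ for any reduced expression $w=s_1\cdots s_k$. The bar involution is the ring automorphism of $\mathbf{H}$ with $\overline{v}=v^{-1}$ and $\overline{H_s}=H_s^{-1}$. The Kazhdan-Lusztig (KL) basis $\{\underline{H}_w : w\in W\}$ is uniquely determined by $\overline{\underline{H}_w}=\underline{H}_w$ and $\underline{H}_w\in H_w+\sum_{x\in W}v\mathbb{Z}[v]H_x$. The left KL pre-order: $x\leq_L y$ (equivalently $y\geq_L x$) if there is $w\in W$ such that $\underline{H}_y$ appears with a non-zero coefficient in the expansion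 of $\underline{H}_w\underline{H}_x$ in the KL basis. *)

(* Defs.v *)
From HB Require Import structures.
From mathcomp Require Import all_boot all_order all_algebra all_fingroup.
From mathcomp Require Import mxrepresentation.
From mathcomp Require Import boolp.

Set Implicit Arguments.
Unset Strict Implicit.
Unset Printing Implicit Defensive.

Import GRing.Theory Num.Theory.
Local Open Scope ring_scope.

Local Notation "p %:F" := (@FracField.tofrac _ p).

(* Z[v, v^-1], as the subring of Frac(Z[v]) of the fractions p / v ^ n. *)
Definition laurent_pred : {pred {fraction {poly int}}} :=
  fun f => `[< exists (n : nat) (p : {poly int}), f = p%:F / 'X%:F ^+ n >].

Fact fracX_neq0 : ('X : {poly int})%:F != 0.
Proof. by rewrite tofrac_eq0 polyX_eq0. Qed.

Fact laurent_subring_closed : subring_closed laurent_pred.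
Proof.
have nz m : ('X : {poly int})%:F ^+ m != 0 by rewrite expf_neq0 ?fracX_neq0.
split.
- by apply/asboolP; exists 0%N, 1; rewrite expr0 divr1 tofrac1.
- move=> _ _ /asboolP[m [p ->]] /asboolP[n [q ->]]; apply/asboolP.
  exists (m + n)%N, (p * 'X ^+ n - q * 'X ^+ m).
  rewrite -mulNr addf_div ?nz // exprD tofracB !tofracM !tofracXn.
  by rewrite mulNr.
- move=> _ _ /asboolP[m [p ->]] /asboolP[n [q ->]]; apply/asboolP.
  by exists (m + n)%N, (p * q); rewrite mulf_div exprD tofracM.
Qed.

HB.instance Definition _ :=
  GRing.isSubringClosed.Build _ laurent_pred laurent_subring_closed.

Record laurent : predArgType :=
  Laurent { laurent_val :> {fraction {poly int}};
            _ : laurent_val \in laurent_pred }.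

HB.instance Definition _ := [isSub for laurent_val].
HB.instance Definition _ := [Choice of laurent by <:].
HB.instance Definition _ := [SubChoice_isSubComNzRing of laurent by <:].

Fact laurent_v_subproof : 'X%:F \in laurent_pred.
Proof. by apply/asboolP; exists 0%N, 'X; rewrite expr0 divr1. Qed.

Fact laurent_vV_subproof : ('X%:F)^-1 \in laurent_pred.
Proof. by apply/asboolP; exists 1%N, 1; rewrite expr1 tofrac1 div1r. Qed.

Definition v : laurent := Laurent laurent_v_subproof.
Definition vV : laurent := Laurent laurent_vV_subproof.

(* The value at v of a polynomial over Z, i.e. the inclusion of Z[v]. *)
Definition evalv (p : {poly int}) : laurent := (map_poly intr p).[v].

Definition dotp (R : realFieldType) (n : nat) (x y : 'rV[R]_n) : R :=
  \sum_(i < n) x 0 i * y 0 i.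

(* x *m reflection a = x - (2 (x, a) / (a, a)) a. *)
Definition reflection (R : realFieldType) (n : nat) (a : 'rV[R]_n) : 'M[R]_n :=
  1%:M - (2 / dotp a a) *: (a^T *m a).

(* Reduced crystallographic root systems in R^n. *)
Record root_system (R : realFieldType) (n : nat) (Phi : seq 'rV[R]_n) : Prop :=
  RootSystem {
    root_span : <<Phi>>%VS = fullv;
    root_neq0 : 0 \notin Phi;
    root_reduced : forall (a : 'rV[R]_n) (c : R),
      a \in Phi -> c *: a \in Phi -> c = 1 \/ c = -1;
    root_stable : forall a b : 'rV[R]_n,
      a \in Phi -> b \in Phi -> b *m reflection a \in Phi;
    root_integral : forall a b : 'rV[R]_n,
      a \in Phi -> b \in Phi ->
      exists k : int, 2 * dotp b a / dotp a a = k%:~R }.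

Record root_base (R : realFieldType) (n : nat) (Phi : seq 'rV[R]_n)
    (Delta : n.-tuple 'rV[R]_n) : Prop :=
  RootBase {
    base_sub : {subset Delta <= Phi};
    base_basis : basis_of fullv Delta;
    base_sign : forall b : 'rV[R]_n, b \in Phi ->
      exists c : 'I_n -> int,
        b = \sum_(i < n) (c i)%:~R *: tnth Delta i /\
        ((forall i, 0 <= c i) \/ (forall i, c i <= 0)) }.

Definition reflections_of (R : realFieldType) (n : nat) (gT : finGroupType)
    (rW : mx_representation R [set: gT] n) (Phi : seq 'rV[R]_n) : {set gT} :=
  [set w | has (fun a => rW w == reflection a) Phi].

(* The group gT is identified, through the faithful representation rW, with
   the group generated by the reflections in the roots. *)
Definition weyl_group (gT : finGroupType) (S : {set gT}) : Prop :=
  exists (R : realFieldType) (n : nat) (Phi : seq 'rV[R]_n)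
         (Delta : n.-tuple 'rV[R]_n) (rW : mx_representation R [set: gT] n),
    [/\ root_system Phi, root_base Phi Delta, mx_faithful rW,
        (forall a, a \in Phi -> exists w, rW w = reflection a) /\
        <<reflections_of rW Phi>>%g = [set: gT]
      & S = reflections_of rW Delta].

Definition parabolic (gT : finGroupType) (S W' : {set gT}) : Prop :=
  exists2 J : {set gT}, J \subset S & W' = <<J>>%g.

(* S ^+ k is the set of products of k elements of S. If S generates the
   group, then every length is at most #|gT|, since the prefixes of a reduced
   expression are pairwise distinct. *)
Definition coxeter_length (gT : finGroupType) (S : {set gT}) (w : gT) : nat :=
  [arg min_(k < (ord_max : 'I_#|gT|.+1) | w \in (S ^+ k)%g) (k : nat)].

Definition reduced_expression (gT : finGroupType) (S : {set gT}) (w : gT)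
    (s : seq gT) : Prop :=
  [/\ all (mem S) s, (\prod_(t <- s) t)%g = w & size s = coxeter_length S w].

Definition longest_element (gT : finGroupType) (S W' : {set gT}) (w0 : gT) :
    Prop :=
  w0 \in W' /\
  forall w, w \in W' -> (coxeter_length S w <= coxeter_length S w0)%N.

(* The product a b a ... of m alternating factors. *)
Definition alternating_prod (B : nzRingType) (a b : B) (m : nat) : B :=
  \prod_(i < m) (if odd i then b else a).

Definition hecke_relations (gT : finGroupType) (S : {set gT})
    (B : algType laurent) (f : gT -> B) : Prop :=
  (forall s, s \in S -> f s ^+ 2 = 1 + (vV - v) *: f s) /\
  (forall s t, s \in S -> t \in S -> s != t ->
     alternating_prod (f s) (f t) #[s * t]%g =
     alternating_prod (f t) (f s) #[s * t]%g).

(* H is the algebra presented by the generators Hb s, for s in S, and the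
   relations above; Hb w is the standard basis element H_w. *)
Record hecke_algebra (gT : finGroupType) (S : {set gT}) (H : algType laurent)
    (Hb : gT -> H) : Prop :=
  HeckeAlgebra {
    hecke_rel : hecke_relations S Hb;
    hecke_univ : forall (B : algType laurent) (f : gT -> B),
      hecke_relations S f ->
      exists phi : {lrmorphism H -> B},
        (forall s, s \in S -> phi (Hb s) = f s) /\
        (forall psi : {lrmorphism H -> B},
           (forall s, s \in S -> psi (Hb s) = f s) -> psi =1 phi);
    hecke_std : forall (w : gT) (s : seq gT),
      reduced_expression S w s -> Hb w = \prod_(t <- s) Hb t }.

Definition bar_involution (gT : finGroupType) (S : {set gT})
    (H : algType laurent) (Hb : gT -> H) (bar : {rmorphism H -> H}) : Prop :=
  [/\ bijective bar, bar v%:A = vV%:A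
    & forall s, s \in S -> Hb s * bar (Hb s) = 1 /\ bar (Hb s) * Hb s = 1].

Definition KL_basis (gT : finGroupType) (H : algType laurent) (Hb : gT -> H)
    (bar : {rmorphism H -> H}) (KL : gT -> H) : Prop :=
  forall w : gT, bar (KL w) = KL w /\
    exists p : gT -> {poly int},
      KL w = Hb w + \sum_(x : gT) (v * evalv (p x)) *: Hb x.

Definition KL_left_le (gT : finGroupType) (H : algType laurent) (KL : gT -> H)
    (x y : gT) : Prop :=
  exists (w : gT) (c : gT -> laurent),
    KL w * KL x = \sum_(z : gT) c z *: KL z /\ c y != 0.

Definition left_ideal_gen (H : algType laurent) (a : H) : H -> Prop :=
  fun h => exists b : H, h = b * a.

(* The span of the KL u with u >=_L x. *)
Definition LM (gT : finGroupType) (H : algType laurent) (KL : gT -> H)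
    (x : gT) : H -> Prop :=
  fun h => exists c : gT -> laurent,
    (forall u, c u != 0 -> KL_left_le KL x u) /\
    h = \sum_(u : gT) c u *: KL u.

(* Main.v *)
(* Let W' be generated by J and let E be the set of h with h H_s = v^-1 h for
   all s in J. Both sides of the theorem equal E.

   If ws < w then KL_w H_s = v^-1 KL_w: pairing x with xs, the coefficients Q_x
   of the bar-invariant element KL_w H_s - v^-1 KL_w lie in Z[v] and satisfy
   Q_x = - v Q_(xs) when xs < x, so a nonzero coefficient of maximal length
   would lie in v Z[v] and be invariant under v <-> v^-1. In particular KL_w0,
   hence the left ideal it generates, lies in E. Comparing coefficients of
   maximal length, the KL_u occurring in an element of E satisfy us < u for all
   s in J, so they lie in E. Finally an element h of E is in the ideal by
   induction on length: a top element y of its support satisfies ys < y for all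
   s in J, so y = x w0 with additive lengths and H_x KL_w0 = H_y + lower terms
   can be subtracted.

   That the H_w form a basis rests on the left regular representation, whose
   braid relations hold because left multiplications commute with right ones,
   and on the uniqueness part of the universal property, which shows that the
   H_s generate H. The geometry of roots supplies the exchange condition. *)

Require Import Defs.
From HB Require Import structures.
From mathcomp Require Import all_boot all_order all_algebra all_fingroup.
From mathcomp Require Import cyclic mxrepresentation.
From mathcomp Require Import boolp zify ring.

Set Implicit Arguments.
Unset Strict Implicit.
Unset Printing Implicit Defensive.

Import Order.TTheory GRing.Theory Num.Theory.
Local Open Scope ring_scope.

(** * Words and lengths *)

Section Words.

Variables (gT : finGroupType) (S : {set gT}).
Local Open Scope group_scope.
Local Notation ell := (coxeter_length S).

Lemma mem_expgs_word k w :
  reflect (exists r, [/\ all (mem S) r, \prod_(t <- r) t = w & size r = k])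
          (w \in S ^+ k).
Proof.
elim: k w => [|k IH] w.
  rewrite expg0; apply: (iffP set1P) => [->|[[|? ?] [_ <- //]]].
    by exists [::]; rewrite big_nil.
  by rewrite big_nil.
rewrite expgS; apply: (iffP mulsgP) => [[s x sS /IH[r [rS <- <-]] ->]|].
  by exists (s :: r); rewrite big_cons /= rS sS.
case=> [[|s r]] [] //= /andP[sS rS] <- [szr]; rewrite big_cons.
by exists s (\prod_(t <- r) t) => //; apply/IH; exists r.
Qed.

(** A word is a walk from 1 in the Cayley graph of [S]; cutting out its loops leaves distinct
    vertices, so the group order bounds its size. *)
Lemma short_word r : all (mem S) r ->
  exists2 r', all (mem S) r' /\ \prod_(t <- r') t = \prod_(t <- r) t
            & (size r' <= #|gT|)%N.
Proof.
move=> rS; pose e := [rel x y : gT | x^-1 * y \in S].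
have [p ep lp] : exists2 p, path e 1 p & last 1 p = \prod_(t <- r) t.
  elim/last_ind: r rS => [|r s IH]; first by exists [::]; rewrite ?big_nil.
  rewrite all_rcons => /andP[sS /IH[p ep lp]].
  exists (rcons p (last 1 p * s)); first by rewrite rcons_path ep /= mulKg.
  by rewrite last_rcons lp -cats1 big_cat /= big_seq1.
rewrite -lp; case/shortenP: ep => q eq uq _.
have words x : path e x q ->
    exists r', [/\ all (mem S) r', x * \prod_(t <- r') t = last x q
                 & size r' = size q].
  elim: q x {eq uq} => [|y q IH] x /=; first by exists [::]; rewrite big_nil mulg1.
  case/andP=> sS /IH[r' [r'S <- <-]]; exists (x^-1 * y :: r').
  by rewrite /= sS r'S big_cons -mulgA mulKVg.
have [r' [r'S <- sz]] := words _ eq.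
exists r'; first by rewrite mul1g.
by rewrite sz ltnW //; have := max_card (mem (1 :: q)); rewrite (card_uniqP uq).
Qed.

(* The default of the [arg min] need not satisfy its condition, so [arg_minnP]
   does not apply directly. *)
Lemma coxeter_length_spec w k : w \in S ^+ k -> (k <= #|gT|)%N ->
  w \in S ^+ ell w /\ (ell w <= k)%N.
Proof.
move=> wk le_k; pose P := [pred k : 'I_#|gT|.+1 | w \in S ^+ k].
have Pk : P (Ordinal (le_k : k < #|gT|.+1)%N) by [].
rewrite /coxeter_length /arg_min /extremum; case: pickP => [i /andP[wi /forallP le_i]|].
  split=> //; exact: implyP (le_i (Ordinal (le_k : k < #|gT|.+1)%N)) Pk.
case: (arg_minnP (fun k : 'I__ => k : nat) Pk) => i /= wi mini /(_ i) /=.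
by rewrite wi; case/negP; apply/forallP=> j; apply/implyP; apply: mini.
Qed.

Lemma coxeter_length_le r :
  all (mem S) r -> (ell (\prod_(t <- r) t) <= size r)%N.
Proof.
(* A word with more than [#|gT|] letters is covered by the range of the [arg min]. *)
move=> rS; case: (leqP (size r) #|gT|) => [szr|/ltnW szr]; last first.
  by apply: leq_trans szr; rewrite -ltnS ltn_ord.
case: (@coxeter_length_spec (\prod_(t <- r) t) _ _ szr) => //.
by apply/mem_expgs_word; exists r.
Qed.

Hypothesis genS : <<S>> = [set: gT].

Lemma gen_word (A : {set gT}) w : w \in <<A>> ->
  exists2 r, all (mem A) r & \prod_(t <- r) t = w.
Proof.
case/gen_prodgP=> n [c Ac ->]; exists [seq c i | i <- index_enum 'I_n].
  by apply/allP=> _ /mapP[i _ ->]; apply: Ac.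
by rewrite big_map.
Qed.

Lemma reduced_exists w : exists r, reduced_expression S w r.
Proof.
have [|r0 rS0 prodr0] := @gen_word S w; first by rewrite genS inE.
have [r1 [r1S prodr1] szr1] := short_word rS0.
case: (@coxeter_length_spec w _ _ szr1).
  by apply/mem_expgs_word; exists r1; rewrite prodr1.
by case/mem_expgs_word=> r [rS <- szr] _; exists r.
Qed.

Lemma coxeter_length1 : ell 1 = 0%N.
Proof.
by apply/eqP; rewrite -leqn0; have := @coxeter_length_le [::] isT; rewrite big_nil.
Qed.

Lemma coxeter_length_mulSl s w : s \in S -> (ell (s * w) <= (ell w).+1)%N.
Proof.
have [r [rS <- <-]] := reduced_exists w => sS.
have /coxeter_length_le : all (mem S) (s :: r) by rewrite /= sS.
by rewrite big_cons.
Qed.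

Hypothesis SV : forall s, s \in S -> s * s = 1.

(** A reversed word in involutions is a word for the inverse. *)
Lemma coxeter_lengthV x : ell x^-1 = ell x.
Proof.
suff le y : (ell y^-1 <= ell y)%N.
  by apply/eqP; rewrite eqn_leq le -{1}(invgK x) le.
have [r [rS <- <-]] := reduced_exists y.
have -> : (\prod_(t <- r) t)^-1 = \prod_(t <- rev r) t.
  elim: r rS => [_|s r IH /= /andP[sS /IH rr]]; first by rewrite !big_nil invg1.
  rewrite rev_cons -cats1 big_cat big_cons big_seq1 invMg rr.
  by congr (_ * _); apply: (mulgI s); rewrite mulgV SV.
by rewrite -size_rev coxeter_length_le ?all_rev.
Qed.

End Words.

(** * Root systems *)

Section InnerProduct.

Variables (R : realFieldType) (n : nat).
Implicit Types x y a b : 'rV[R]_n.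

Lemma dotpC x y : dotp x y = dotp y x.
Proof. by apply: eq_bigr => i _; rewrite mulrC. Qed.

Lemma dotpDl x y z : dotp (x + y) z = dotp x z + dotp y z.
Proof. by rewrite -big_split; apply: eq_bigr => i _; rewrite mxE mulrDl. Qed.

Lemma dotpZl c x z : dotp (c *: x) z = c * dotp x z.
Proof. by rewrite mulr_sumr; apply: eq_bigr => i _; rewrite mxE mulrA. Qed.

Lemma dotp_suml (I : finType) (F : I -> 'rV[R]_n) z :
  dotp (\sum_i F i) z = \sum_i dotp (F i) z.
Proof.
rewrite /dotp exchange_big /=; apply: eq_bigr => j _.
by rewrite summxE mulr_suml.
Qed.

Lemma dotp_gt0 a : a != 0 -> 0 < dotp a a.
Proof.
move=> a0; rewrite lt_def; have ge0 i : 0 <= a 0 i * a 0 i by rewrite -expr2 sqr_ge0.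
rewrite sumr_ge0 // andbT; apply: contra a0 => /eqP/psumr_eq0P a0.
apply/eqP/rowP=> i; rewrite mxE; apply/eqP.
by have /eqP := a0 (fun i _ => ge0 i) i isT; rewrite mulf_eq0 orbb.
Qed.

Lemma mul_reflection x a :
  x *m reflection a = x - (2 * dotp x a / dotp a a) *: a.
Proof.
rewrite /reflection mulmxBr mulmx1 -scalemxAr mulmxA.
have -> : x *m a^T = (dotp x a)%:M.
  rewrite [LHS]mx11_scalar; congr (_%:M); rewrite mxE.
  by apply: eq_bigr => i _; rewrite mxE.
by rewrite mul_scalar_mx scalerA mulrAC.
Qed.

Lemma dotp_reflection x y a : a != 0 ->
  dotp (x *m reflection a) (y *m reflection a) = dotp x y.
Proof.
move/dotp_gt0/lt0r_neq0=> a0; rewrite !mul_reflection -!scaleNr.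
rewrite dotpDl ![dotp _ (y + _)]dotpC !dotpDl !dotpZl.
rewrite ![dotp _ (_ *: _)]dotpC !dotpZl.
by rewrite ?[dotp a x]dotpC ?[dotp a y]dotpC ?[dotp y x]dotpC; field.
Qed.

Lemma reflection_root a : a != 0 -> a *m reflection a = - a.
Proof.
move/dotp_gt0/lt0r_neq0=> a0; rewrite mul_reflection mulfK //.
by rewrite scaler_nat mulr2n opprD addrA subrr sub0r.
Qed.

Lemma reflectionK a : a != 0 -> reflection a *m reflection a = 1%:M.
Proof.
move=> a0; apply/row_matrixP=> i; rewrite !rowE mulmxA mulmx1.
set x := delta_mx _ _; rewrite [x *m _]mul_reflection mulmxBl -scalemxAl.
by rewrite reflection_root // scalerN opprK mul_reflection subrK.
Qed.

Lemma reflectionZ c a : c != 0 -> reflection (c *: a) = reflection a.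
Proof.
move=> c0; rewrite /reflection [(c *: a)^T]linearZ /= -scalemxAl -scalemxAr !scalerA.
congr (_ - _ *: _); rewrite dotpZl dotpC dotpZl.
(* If [dotp a a] is 0, both coefficients are 0, the inverse of 0 being 0. *)
have [->|d0] := eqVneq (dotp a a) 0; first by rewrite !mulr0 invr0 mulr0 !mul0r.
by field; rewrite c0 d0.
Qed.

Lemma reflectionN a : reflection (- a) = reflection a.
Proof. by rewrite -scaleN1r reflectionZ // oppr_eq0 oner_eq0. Qed.

End InnerProduct.

Section Roots.

Variables (R : realFieldType) (n : nat) (Phi : seq 'rV[R]_n).
Variables (Delta : n.-tuple 'rV[R]_n).
Variables (gT : finGroupType) (rW : mx_representation R [set: gT] n).
Hypotheses (rootPhi : root_system Phi) (baseDelta : root_base Phi Delta).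
Hypothesis faithful_rW : mx_faithful rW.
Hypothesis rW_reflection :
  forall a, a \in Phi -> exists w, rW w = reflection a.
Hypothesis gen_reflections : <<reflections_of rW Phi>>%g = [set: gT].

Implicit Types (a b : 'rV[R]_n) (i j : 'I_n) (w x y z g s t : gT).

Local Notation D i := (tnth Delta i).
Local Notation S := (reflections_of rW Delta).
Local Notation cf i := (coord Delta i).
Local Notation pos b := [forall i, 0 <= cf i b].

Lemma rWM x y : rW (x * y)%g = rW x *m rW y.
Proof. by rewrite repr_mxM ?inE. Qed.

Lemma rWK x : rW x *m rW x^-1%g = 1%:M.
Proof. by rewrite -rWM mulgV repr_mx1. Qed.

Lemma rW_inj x y : rW x = rW y -> x = y.
Proof. by move=> eq_xy; apply: (mx_faithful_inj faithful_rW); rewrite ?inE. Qed.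

Lemma simple_in_Phi i : D i \in Phi.
Proof. by rewrite (base_sub baseDelta) ?mem_tnth. Qed.

Lemma root_nz a : a \in Phi -> a != 0.
Proof. by apply: contraTneq => ->; rewrite (root_neq0 rootPhi). Qed.

Lemma reflection_simple s : s \in S -> exists i, rW s = reflection (D i).
Proof. by rewrite inE => /hasP[a /tnthP[i ->] /eqP]; exists i. Qed.

Lemma simple_reflection i : exists2 s, s \in S & rW s = reflection (D i).
Proof.
have [s sE] := rW_reflection (simple_in_Phi i); exists s => //.
by rewrite inE; apply/hasP; exists (D i); rewrite ?mem_tnth ?sE.
Qed.

Lemma simple_involutive s : s \in S -> (s * s = 1)%g.
Proof.
case/reflection_simple=> i sE; apply: rW_inj.
by rewrite rWM sE repr_mx1 reflectionK // root_nz ?simple_in_Phi.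
Qed.

Lemma rootN a : a \in Phi -> - a \in Phi.
Proof.
by move=> aP; rewrite -(reflection_root (root_nz aP)) (root_stable rootPhi).
Qed.

Lemma reflections_gen_ind (P : gT -> Prop) :
  P 1%g -> (forall w a g, P w -> a \in Phi -> rW g = reflection a -> P (g * w)%g) ->
  forall w, P w.
Proof.
move=> P1 PM w; have [|r] := @gen_word _ (reflections_of rW Phi) w.
  by rewrite gen_reflections inE.
elim: r w => [|g r IH] w /=; first by rewrite big_nil => _ <-.
rewrite inE big_cons => /andP[/hasP[a aP /eqP gE] rP] <-.
by apply: PM gE => //; apply: IH.
Qed.

Lemma root_act a w : a \in Phi -> a *m rW w \in Phi.
Proof.
move: w a; apply: reflections_gen_ind => [|w b g IH bP gE] a aP.
  by rewrite repr_mx1 mulmx1.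
by rewrite rWM gE mulmxA; apply: IH; apply: (root_stable rootPhi).
Qed.

(** The representation is orthogonal because reflections generate the group. *)
Lemma dotp_act a b w : dotp (a *m rW w) (b *m rW w) = dotp a b.
Proof.
move: w a b; apply: reflections_gen_ind => [|w c g IH cP gE] a b.
  by rewrite repr_mx1 !mulmx1.
by rewrite rWM gE !mulmxA IH dotp_reflection // root_nz.
Qed.

(** An orthogonal map conjugates a reflection into the reflection in the image root. Vectors are
    rows, so [w] stands on the right of the conjugate. *)
Lemma reflection_act a g w :
  rW g = reflection a -> rW (w^-1 * g * w)%g = reflection (a *m rW w).
Proof.
move=> gE; rewrite !rWM gE; apply/row_matrixP=> i; rewrite !rowE !mulmxA.
set x := delta_mx _ _; rewrite !mul_reflection mulmxBl -scalemxAl -mulmxA.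
rewrite -{2}[w]invgK rWK mulmx1 dotp_act; congr (_ - (_ * _ / _) *: _).
by rewrite -[RHS](dotp_act _ _ w^-1%g) -mulmxA rWK mulmx1.
Qed.

Lemma coord_Delta i j : cf i (D j) = (j == i)%:R.
Proof. by rewrite (tnth_nth 0) coord_free // (basis_free (base_basis baseDelta)). Qed.

Lemma coord_sumD b : b = \sum_i cf i b *: D i.
Proof.
rewrite {1}(coord_basis (base_basis baseDelta) (memvf b)).
by apply: eq_bigr => i _; rewrite (tnth_nth 0).
Qed.

Lemma coord_root b : b \in Phi ->
  exists c : 'I_n -> int, (forall i, cf i b = (c i)%:~R) /\
    ((forall i, 0 <= c i) \/ (forall i, c i <= 0)).
Proof.
case/(base_sign baseDelta)=> c [-> cP]; exists c; split=> // i.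
rewrite linear_sum (bigD1 i) //= linearZ /= coord_Delta eqxx mulr1.
rewrite big1 ?addr0 // => j ji.
by rewrite linearZ /= coord_Delta (negPf ji) mulr0.
Qed.

Lemma npos_le0 b i : b \in Phi -> ~~ pos b -> cf i b <= 0.
Proof.
case/coord_root=> c [cE [c0|c0]]; last by rewrite cE lerz0 c0.
by case/forallP=> j; rewrite cE ler0z c0.
Qed.

Lemma le0_npos b : b \in Phi -> (forall i, cf i b <= 0) -> ~~ pos b.
Proof.
move=> bP le0; apply: contra (root_nz bP) => /forallP ge0.
rewrite [b]coord_sumD big1 // => i _.
by rewrite (@le_anti _ _ (cf i b) 0) ?scale0r // le0 ge0.
Qed.

Lemma gt0_pos b i : b \in Phi -> 0 < cf i b -> pos b.
Proof. by move=> bP; apply: contraTT => /(npos_le0 i bP); rewrite leNgt. Qed.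

Lemma pos_simple i : pos (D i).
Proof. by apply/forallP=> j; rewrite coord_Delta ler0n. Qed.

Lemma posN b : b \in Phi -> pos (- b) = ~~ pos b.
Proof.
move=> bP; apply/idP/idP => [/forallP bN|/npos_le0 bN].
  by apply: le0_npos => // i; rewrite -oppr_ge0 -linearN bN.
by apply/forallP=> i; rewrite linearN oppr_ge0 bN.
Qed.

(** The reflection in [D i] changes only coordinate [i]. Some other coordinate of [b] is positive,
    since otherwise [b] would be a multiple of [D i], hence [D i] itself by reducedness. *)
Lemma pos_act_simple b i :
  b \in Phi -> b != D i -> pos b -> pos (b *m reflection (D i)).
Proof.
move=> bP b_i b_pos; have bsP := root_stable rootPhi (simple_in_Phi i) bP.
have [/existsP[j /andP[ji bj]]|] := boolP [exists j, (j != i) && (0 < cf j b)].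
  apply: (@gt0_pos _ j) => //; rewrite mul_reflection linearB linearZ /=.
  by rewrite coord_Delta eq_sym (negPf ji) mulr0 subr0.
rewrite negb_exists => /forallP b0; case/eqP: b_i.
have bE : b = cf i b *: D i.
  rewrite {1}[b]coord_sumD (bigD1 i) //= big1 ?addr0 // => j ji.
  have := b0 j; rewrite ji /= -leNgt => bj.
  by rewrite (@le_anti _ _ (cf j b) 0) ?scale0r // bj (forallP b_pos).
case: (root_reduced rootPhi (simple_in_Phi i) (c := cf i b)); rewrite -?bE //.
  by move=> c1; rewrite bE c1 scale1r.
by move=> c1; have := forallP b_pos i; rewrite c1 oppr_ge0 ler10.
Qed.

Lemma npos_act_simple b i :
  b \in Phi -> pos b -> ~~ pos (b *m reflection (D i)) -> b = D i.
Proof. by move=> bP bpos; apply: contraNeq => /pos_act_simple->. Qed.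

(** Induction on the height of a positive root [b]: some simple root has a positive inner product
    with [b], reflecting in it lowers the height, and the reflection in [b] is a conjugate of the
    one in the lower root. *)
Lemma gen_simple : <<S>>%g = [set: gT].
Proof.
apply/eqP; rewrite eqEsubset subsetT -gen_reflections gen_subG.
suff posS (N : nat) b : b \in Phi -> pos b -> \sum_i cf i b <= N%:R ->
    exists2 w, w \in <<S>>%g & rW w = reflection b.
  apply/subsetP=> w; rewrite inE => /hasP[a aP /eqP wE].
  wlog apos : a aP wE / pos a.
    move=> wl; have [|aN] := boolP (pos a); first exact: wl.
    by apply: (wl (- a)); rewrite ?rootN ?reflectionN ?posN.
  (* [R] need not be archimedean: the natural number that bounds the height comes from the
     integrality of the coordinates. *)
  have [c [cE _]] := coord_root aP.
  have [|||w' w'S w'E] := @posS (absz (\sum_i c i)) a => //.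
    rewrite (eq_bigr _ (fun i _ => cE i)) -rmorph_sum /= pmulrn ler_int.
    by rewrite abszE ler_norm.
  by rewrite (@rW_inj w w') // wE.
elim: N b => [|N IH] b bP bpos htb.
  case/negP: (root_nz bP); rewrite [b]coord_sumD.
  have /psumr_eq0P b0 : \sum_i cf i b = 0.
    by apply/le_anti; rewrite htb sumr_ge0 // => i _; apply: (forallP bpos).
  by rewrite big1 // => i _; rewrite b0 ?scale0r // => j _; apply: (forallP bpos).
have [i bi] : exists i, 0 < dotp b (D i).
  apply/existsP; apply: contraLR (dotp_gt0 (root_nz bP)).
  rewrite negb_exists => /forallP b0; rewrite -leNgt {1}[b]coord_sumD dotp_suml.
  apply: sumr_le0 => i _; rewrite dotpZl dotpC mulr_ge0_le0 ?(forallP bpos) //.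
  by rewrite leNgt b0.
have [s sS sE] := simple_reflection i.
have [->|b_i] := eqVneq b (D i); first by exists s; rewrite ?mem_gen.
have sV : (s^-1 = s)%g by apply: (mulgI s); rewrite mulgV simple_involutive.
have bsP := root_stable rootPhi (simple_in_Phi i) bP.
have [|||w wS wE] := IH (b *m reflection (D i)) => //; first exact: pos_act_simple.
  (* The amount subtracted from the height is a positive integer, hence at least 1. *)
  have [k kE] := root_integral rootPhi (simple_in_Phi i) bP.
  have ai0 := dotp_gt0 (root_nz (simple_in_Phi i)).
  have k1 : 1 <= k%:~R :> R.
    rewrite ler1z -gtz0_ge1 -(ltr0z R) -kE divr_gt0 // mulr_gt0 //.
  rewrite mul_reflection kE.
  under eq_bigr => j _ do rewrite linearB linearZ /= coord_Delta.
  have sum_i : \sum_j (i == j)%:R = 1 :> R.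
    by rewrite (bigD1 i) //= eqxx big1 ?addr0 // => j; rewrite eq_sym => /negPf->.
  by rewrite sumrB -mulr_sumr sum_i mulr1 lerBlDr (le_trans htb) // -natr1 lerD2l.
exists (s^-1 * w * s)%g; first by rewrite !groupM ?groupV ?(mem_gen sS).
rewrite (reflection_act _ wE) sE -mulmxA reflectionK ?mulmx1 //.
exact/root_nz/simple_in_Phi.
Qed.

(** Follow [b] through the prefixes of [r]. The letter that first makes it negative must be the
    reflection in its current image, by [npos_act_simple]; deleting that letter amounts to
    multiplying by [g]. *)
Lemma exchange r b g : all (mem S) r -> b \in Phi -> pos b ->
    rW g = reflection b -> ~~ pos (b *m rW (\prod_(t <- r) t)%g) ->
  exists r', [/\ all (mem S) r', (\prod_(t <- r') t = g * \prod_(t <- r) t)%g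
               & (size r').+1 = size r].
Proof.
elim: r b g => [|t r IH] b g /=.
  by rewrite big_nil repr_mx1 mulmx1 => _ _ ->.
case/andP=> tS rS bP bpos gE; have [i tE] := reflection_simple tS.
rewrite big_cons rWM mulmxA tE.
have [btpos|btN] := boolP (pos (b *m reflection (D i))); last first.
  exists r; split=> //.
  have -> : g = t by apply: rW_inj; rewrite gE tE (npos_act_simple bP bpos btN).
  by rewrite mulgA simple_involutive ?mul1g.
rewrite -tE in btpos *.
case/(IH _ (t^-1 * g * t)%g rS (root_act t bP) btpos (reflection_act t gE)).
move=> r' [r'S r'E szr']; exists (t :: r'); rewrite /= tS szr'; split=> //.
by rewrite big_cons r'E !mulgA mulgV mul1g.
Qed.

Local Notation ell := (coxeter_length S).

Lemma reflection_length_lt b g w : b \in Phi -> pos b -> rW g = reflection b ->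
  ~~ pos (b *m rW w) -> (ell (g * w) < ell w)%N.
Proof.
have [r [rS <- <-]] := reduced_exists gen_simple w.
move=> bP bpos gE /(exchange rS bP bpos gE)[r' [r'S <- <-]].
exact: coxeter_length_le.
Qed.

(** If the image of [D i] is negative, exchange applies. If it is positive, exchange applies to
    [s * w], which sends [D i] to the opposite root. *)
Lemma simple_length_lt s i w : s \in S -> rW s = reflection (D i) ->
  (ell (s * w) < ell w)%N = ~~ pos (D i *m rW w).
Proof.
move=> sS sE; apply/idP/idP => [|aN]; last first.
  exact: reflection_length_lt (simple_in_Phi i) (pos_simple i) sE aN.
apply: contraTN => apos; rewrite -leqNgt ltnW //.
have {1}-> : w = (s * (s * w))%g by rewrite mulgA simple_involutive ?mul1g.
apply: (reflection_length_lt (simple_in_Phi i) (pos_simple i) sE).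
rewrite rWM sE mulmxA reflection_root ?root_nz ?simple_in_Phi // mulNmx.
by rewrite posN ?negbK ?root_act ?simple_in_Phi.
Qed.

Lemma simple_length_neq s w : s \in S -> ell (s * w)%g != ell w.
Proof.
move=> sS; have [i sE] := reflection_simple sS.
have lt1 := simple_length_lt w sS sE.
have := simple_length_lt (s * w)%g sS sE.
rewrite mulgA simple_involutive // mul1g rWM mulmxA sE.
rewrite reflection_root ?root_nz ?simple_in_Phi // mulNmx.
rewrite posN ?negbK ?root_act ?simple_in_Phi // => lt2.
by rewrite neq_ltn lt1 lt2 orNb.
Qed.

(** By [simple_length_lt] the claim compares the signs of a root before and after [t] acts. The sign
    changes only at plus or minus the simple root of [t], which would force [s * w = w * t]. *)
Lemma simple_length_mulr s t w : s \in S -> t \in S -> (s * w != w * t)%g ->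
  (ell (s * w * t) < ell (w * t))%N = (ell (s * w) < ell w)%N.
Proof.
move=> sS tS sw_wt.
have [i sE] := reflection_simple sS.
have [j tE] := reflection_simple tS.
rewrite -mulgA !(simple_length_lt _ sS sE) rWM mulmxA tE; congr (~~ _).
set b := D i *m rW w; have bP : b \in Phi by rewrite root_act ?simple_in_Phi.
have conj_ne : reflection b != reflection (D j).
  rewrite -(reflection_act w sE) -tE; apply: contra sw_wt => /eqP/rW_inj <-.
  by rewrite !mulgA mulgV mul1g.
have b_j : b != D j by apply: contra conj_ne => /eqP->.
have bNj : - b != D j by apply: contra conj_ne => /eqP <-; rewrite reflectionN.
have [bpos|bN] := boolP (pos b); first exact: pos_act_simple.
apply/negbTE; rewrite -posN ?(root_stable rootPhi) ?simple_in_Phi // -mulNmx.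
by apply: pos_act_simple; rewrite ?rootN ?posN.
Qed.

(** * Roots in the span of a set of simple reflections *)

Section Parabolic.

Variables (J : {set gT}) (y : gT).
Hypothesis sJS : J \subset S.
Hypothesis descJ : forall s, s \in J -> (ell (s * y) < ell y)%N.

(* Under [descJ], y makes negative every positive root in the span of J. *)
Let spanJ b := forall i, cf i b != 0 -> exists2 s, s \in J & rW s = reflection (D i).

Lemma parabolic_root_act b z : spanJ b -> z \in <<J>>%g -> spanJ (b *m rW z).
Proof.
move=> bJ /gen_word[r rJ <-]; elim: r b bJ rJ => [|s r IH] b bJ /=.
  by rewrite big_nil repr_mx1 mulmx1.
case/andP=> sJ rJ; rewrite big_cons rWM mulmxA; apply: IH rJ.
have [j sE] := reflection_simple (subsetP sJS _ sJ).
rewrite sE => i; rewrite mul_reflection linearB linearZ /= coord_Delta.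
have [<- _|_] := eqVneq j i; first by exists s.
by rewrite mulr0 subr0; apply: bJ.
Qed.

(** Such a root is a nonnegative combination of simple roots that [y] makes negative. *)
Lemma parabolic_root_descent b : b \in Phi -> spanJ b -> pos b -> ~~ pos (b *m rW y).
Proof.
move=> bP bJ bpos; apply: le0_npos => [|k]; first exact: root_act.
rewrite [b in b *m _]coord_sumD mulmx_suml linear_sum sumr_le0 // => i _.
rewrite -scalemxAl linearZ /=.
have [->|/bJ[s sJ sE]] := eqVneq (cf i b) 0; first by rewrite mul0r.
rewrite mulr_ge0_le0 ?(forallP bpos) // npos_le0 ?root_act ?simple_in_Phi //.
by rewrite -(simple_length_lt _ _ sE) ?descJ ?(subsetP sJS).
Qed.

(** Induction on any word for [z]. The image of the simple root of [s] under [z] stays in the span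
    of [J], where [y] reverses signs; so prepending [s] lengthens [z] exactly when it shortens
    [z * y]. *)
Lemma parabolic_length z : z \in <<J>>%g -> (ell (z * y) + ell z = ell y)%N.
Proof.
case/gen_word=> r rJ <-; elim: r rJ => [_|s r IH /=].
  by rewrite big_nil mul1g coxeter_length1 addn0.
case/andP=> sJ rJ; rewrite big_cons; move: (IH rJ).
have : (\prod_(t <- r) t)%g \in <<J>>%g.
  by rewrite big_seq group_prod // => t tr; apply/mem_gen/(allP rJ).
clear z; move: (\prod_(t <- r) t)%g => z zJ zE.
have sS := subsetP sJS _ sJ; have [i sE] := reflection_simple sS.
have le_s x : (ell (s * x) <= (ell x).+1)%N.
  exact: coxeter_length_mulSl gen_simple _ _ sS.
have ge_s x : (ell x <= (ell (s * x)).+1)%N.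
  by rewrite -{1}[x]mul1g -(simple_involutive sS) -mulgA le_s.
have ne_s x := simple_length_neq x sS.
suff : (ell (s * (z * y)) < ell (z * y))%N = ~~ (ell (s * z) < ell z)%N.
  have arith (a a' b b' c : nat) : (a' <= a.+1 -> a <= a'.+1 -> a' != a ->
      b' <= b.+1 -> b <= b'.+1 -> b' != b -> a + b = c ->
      (a' < a) = ~~ (b' < b) -> a' + b' = c)%N by clear; lia.
  by rewrite -mulgA; apply: arith.
rewrite !(simple_length_lt _ sS sE) negbK rWM mulmxA.
have bP : D i *m rW z \in Phi by rewrite root_act ?simple_in_Phi.
have bJ : spanJ (D i *m rW z).
  apply: parabolic_root_act zJ => j; rewrite coord_Delta.
  by have [<-|] := eqVneq i j; [exists s | rewrite eqxx].
apply/idP/idP => [|bpos]; last exact: parabolic_root_descent.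
(* A negative root is treated through its opposite. *)
apply: contraR => bN; rewrite -[D i *m rW z]opprK mulNmx posN; last first.
  by rewrite root_act // rootN.
apply: parabolic_root_descent; rewrite ?rootN ?posN // => j.
by rewrite linearN oppr_eq0; apply: bJ.
Qed.

End Parabolic.

End Roots.

(** * Coxeter combinatorics of a Weyl group *)

Section Coxeter.

Variables (gT : finGroupType) (S : {set gT}).
Hypothesis weylS : weyl_group S.
Local Notation ell := (coxeter_length S).
Implicit Types (s t w x y z : gT) (J : {set gT}).
Local Open Scope group_scope.

Lemma weyl_gen : <<S>> = [set: gT].
Proof.
case: weylS => [R [n [Phi [Delta [rW [rootP baseD fW [rW_refl genW] ->]]]]]].
exact: (gen_simple rootP baseD fW rW_refl genW).
Qed.

Lemma weyl_involutive s : s \in S -> s * s = 1.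
Proof.
case: weylS => [R [n [Phi [Delta [rW [rootP baseD fW [rW_refl genW] ->]]]]]].
exact: (simple_involutive rootP baseD fW).
Qed.

Lemma weyl_simpleV s : s \in S -> s^-1 = s.
Proof. by move=> sS; apply: (mulgI s); rewrite mulgV weyl_involutive. Qed.

Lemma weyl_mulKl s w : s \in S -> s * (s * w) = w.
Proof. by move=> sS; rewrite mulgA weyl_involutive ?mul1g. Qed.

Lemma weyl_mulKr s w : s \in S -> w * s * s = w.
Proof. by move=> sS; rewrite -mulgA weyl_involutive ?mulg1. Qed.

Lemma weyl_lengthV w : ell w^-1 = ell w.
Proof. exact: coxeter_lengthV weyl_gen weyl_involutive w. Qed.

Lemma weyl_length_mull s w : s \in S ->
  ell (s * w) = if (ell (s * w) < ell w)%N then (ell w).-1 else (ell w).+1.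
Proof.
case: weylS => [R [n [Phi [Delta [rW [rootP baseD fW [rW_refl genW] SE]]]]]] sS.
have ne : ell (s * w) != ell w.
  by move: sS; rewrite SE => sS; apply: (simple_length_neq rootP baseD fW rW_refl genW).
have le1 := coxeter_length_mulSl weyl_gen w sS.
have le2 := coxeter_length_mulSl weyl_gen (s * w) sS.
rewrite weyl_mulKl // in le2.
have arith (a b : nat) : (b <= a.+1 -> a <= b.+1 -> b != a ->
    b = if b < a then a.-1 else a.+1)%N by clear; case: ltnP; lia.
exact: arith.
Qed.

Lemma weyl_length_mulr s w : s \in S ->
  ell (w * s) = if (ell (w * s) < ell w)%N then (ell w).-1 else (ell w).+1.
Proof.
move=> sS; rewrite -weyl_lengthV -[ell w]weyl_lengthV invMg (weyl_simpleV sS).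
exact: weyl_length_mull.
Qed.

Lemma weyl_length_lt_mull s w : s \in S ->
  (ell w < ell (s * w))%N = ~~ (ell (s * w) < ell w)%N.
Proof. by move/(weyl_length_mull w); case: ltnP; lia. Qed.

Lemma weyl_length_lt_mulr s w : s \in S ->
  (ell w < ell (w * s))%N = ~~ (ell (w * s) < ell w)%N.
Proof. by move/(weyl_length_mulr w); case: ltnP; lia. Qed.

Lemma weyl_descent_mulr s t w : s \in S -> t \in S -> s * w != w * t ->
  (ell (s * w * t) < ell (w * t))%N = (ell (s * w) < ell w)%N.
Proof.
case: weylS => [R [n [Phi [Delta [rW [rootP baseD fW [rW_refl genW] ->]]]]]].
exact: (simple_length_mulr rootP baseD fW rW_refl genW).
Qed.

(** The mirror image of [weyl_descent_mulr] under inversion. *)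
Lemma weyl_descent_mull s t w : s \in S -> t \in S -> s * w != w * t ->
  (ell (s * w * t) < ell (s * w))%N = (ell (w * t) < ell w)%N.
Proof.
move=> sS tS sw_wt; rewrite -[LHS](_ : (ell (t * w^-1 * s) < ell (w^-1 * s))%N = _).
  rewrite weyl_descent_mulr //; last first.
    rewrite -(inj_eq invg_inj) !invMg invgK !weyl_simpleV //.
    by rewrite eq_sym.
  by rewrite -{1}(weyl_simpleV tS) -invMg !weyl_lengthV.
by rewrite -{1}(weyl_simpleV tS) -{1 2}(weyl_simpleV sS) -!invMg !weyl_lengthV mulgA.
Qed.

Lemma weyl_parabolic_length J y z : J \subset S ->
  (forall s, s \in J -> (ell (s * y) < ell y)%N) -> z \in <<J>> ->
  (ell (z * y) + ell z = ell y)%N.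
Proof.
case: weylS => [R [n [Phi [Delta [rW [rootP baseD fW [rW_refl genW] ->]]]]]].
by move=> sJS descJ; apply: (parabolic_length rootP baseD fW rW_refl genW sJS descJ).
Qed.

Lemma weyl_simple_length s : s \in S -> ell s = 1%N.
Proof.
by move=> sS; have := weyl_length_mull 1 sS; rewrite mulg1 coxeter_length1.
Qed.

Lemma weyl_left_descent w : w != 1 -> exists2 s, s \in S & (ell (s * w) < ell w)%N.
Proof.
have [[|s r] [rS <- szr]] := reduced_exists weyl_gen w; first by rewrite big_nil eqxx.
case/andP: rS => sS rS _; exists s => //.
by rewrite -szr big_cons weyl_mulKl // ltnS coxeter_length_le.
Qed.

(** * Alternating words in two simple reflections *)

Fixpoint alternating_word s t m : gT :=
  if m is m'.+1 then s * alternating_word t s m' else 1.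

Lemma alternating_wordSr s t m :
  alternating_word s t m.+1 = alternating_word s t m * (if odd m then t else s).
Proof.
elim: m s t => [|m IH] s t; first by rewrite /= mul1g mulg1.
rewrite [LHS]/= -/(alternating_word t s m.+1) IH mulgA /=.
by rewrite if_neg.
Qed.

(** When [m] is the order of [s * t] this is the braid relation in the group; for smaller positive
    [m] the two words differ. *)
Lemma alternating_word_swap s t m : s \in S -> t \in S ->
  alternating_word s t m = (s * t) ^+ m * alternating_word t s m.
Proof.
move=> sS tS; elim: m s t sS tS => [|m IH] s t sS tS; first by rewrite mulg1.
have comm_st : s * (t * s) ^+ m = (s * t) ^+ m * s.
  by elim: m {IH} => [|m IH]; rewrite ?mulg1 ?mul1g // expgSr mulgA IH expgSr !mulgA.
by rewrite [LHS]/= (IH t s) // mulgA comm_st expgSr /= -!mulgA (weyl_mulKl _ tS).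
Qed.

Lemma alternating_word_length s t m : s \in S -> t \in S ->
  (m <= #[s * t]%g)%N -> ell (alternating_word s t m) = m.
Proof.
move=> sS tS; move: m s t sS tS.
(* All lengths up to [m] are treated together, because the step also uses the word two letters
   shorter. *)
suff IH m : forall s t, s \in S -> t \in S -> (m <= #[s * t]%g)%N ->
    forall k, (k <= m)%N -> ell (alternating_word s t k) = k.
  by move=> m s t sS tS le_m; apply: (IH m).
elim: m => [|m IH] s t sS tS le_m k.
  by rewrite leqn0 => /eqP->; rewrite coxeter_length1.
rewrite leq_eqVlt ltnS => /predU1P[->|]; last exact: (IH s t sS tS (ltnW le_m)).
have le_m' : (m.+1 <= #[t * s]%g)%N.
  by rewrite -orderV invMg !weyl_simpleV.
have st := IH s t sS tS (ltnW le_m); have ts := IH t s tS sS (ltnW le_m').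
case: m {IH} le_m le_m' st ts => [|m] le_m le_m' st ts.
  by rewrite /= mulg1 weyl_simple_length.
set u := if odd m then s else t.
have uS : u \in S by rewrite /u; case: odd.
have tsE : alternating_word t s m.+1 = alternating_word t s m * u.
  by rewrite alternating_wordSr.
(* Equality would make the two alternating words of length [m.+1] agree, although [m.+1] is below
   the order. Hence [s], which lengthens the word of length [m], still lengthens it after [u] is
   appended. *)
have ne : s * alternating_word t s m != alternating_word t s m * u.
  rewrite -tsE -[s * _]/(alternating_word s t m.+1) alternating_word_swap //.
  rewrite -{2}[alternating_word t s m.+1]mul1g (inj_eq (mulIg _)) -order_dvdn.
  by rewrite gtnNdvd.
have := weyl_descent_mulr sS uS ne; rewrite -mulgA -tsE.
rewrite -[s * alternating_word t s m]/(alternating_word s t m.+1).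
rewrite -[s * alternating_word t s m.+1]/(alternating_word s t m.+2).
rewrite (st m.+1) // (ts m) // [in RHS]ltnNge leqnSn /= => ndesc.
have := weyl_length_mull (alternating_word t s m.+1) sS.
by rewrite -[s * _]/(alternating_word s t m.+2) ndesc ts.
Qed.

End Coxeter.

(** * The regular representation of the Hecke algebra *)

Lemma mulvV : v * vV = 1.
Proof. by apply: val_inj; rewrite /= divff // fracX_neq0. Qed.

(** The image of [evalv p] under the exchange of [v] and [vV]. *)
Definition evalvV (p : {poly int}) : laurent := (map_poly intr p).[vV].

Lemma evalvD p q : evalv (p + q) = evalv p + evalv q.
Proof. by rewrite /evalv rmorphD hornerD. Qed.

Lemma evalvN p : evalv (- p) = - evalv p.
Proof. by rewrite /evalv rmorphN hornerN. Qed.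

Lemma evalvM p q : evalv (p * q) = evalv p * evalv q.
Proof. by rewrite /evalv rmorphM hornerM. Qed.

Lemma evalvX : evalv 'X = v.
Proof. by rewrite /evalv map_polyX hornerX. Qed.

Lemma evalvC c : evalv c%:P = c%:~R.
Proof. by rewrite /evalv map_polyC hornerC. Qed.

Lemma laurent_val_evalv p : laurent_val (evalv p) = FracField.tofrac p.
Proof.
elim/poly_ind: p => [|p c IH]; first by rewrite /evalv rmorph0 horner0 tofrac0.
rewrite evalvD evalvM evalvX evalvC tofracD tofracM -IH /=.
have -> : c%:P = c%:~R :> {poly int} by rewrite -{1}[c]intz rmorph_int.
rewrite rmorph_int; congr (_ + _).
exact: (rmorph_int (\val : laurent -> {fraction {poly int}}) c).
Qed.

Lemma evalv_inj : injective evalv.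
Proof.
move=> p q /(congr1 laurent_val)/eqP.
by rewrite !laurent_val_evalv tofrac_eq => /eqP.
Qed.

(** Multiplying by [v ^+ d], with [d] the size of [p], turns the equation into one between the
    polynomials ['X^d * p] and [r]. The latter has degree at most [d], so the coefficients of [p] in
    positive degree vanish. *)
Lemma evalv_symmetric p : evalv p = evalvV p -> p = (p`_0)%:P.
Proof.
move=> sym_p; pose d := size p.
have evalE (x : laurent) : (map_poly intr p).[x] = \sum_(i < d) (p`_i)%:~R * x ^+ i.
  rewrite -{1}(coefK p) poly_def rmorph_sum horner_sum; apply: eq_bigr => i _ /=.
  by rewrite map_polyZ hornerZ map_polyXn hornerXn.
pose r : {poly int} := \sum_(i < d) p`_i *: 'X^(d - i).
have /evalv_inj /polyP pr : evalv ('X^d * p) = evalv r.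
  rewrite evalvM sym_p /evalvV evalE mulr_sumr /evalv /r rmorph_sum horner_sum.
  apply: eq_bigr => i _ /=; rewrite map_polyXn hornerXn map_polyZ hornerZ.
  rewrite map_polyXn hornerXn mulrCA; congr (_ * _).
  by rewrite -{1}(subnK (ltnW (ltn_ord i))) exprD -mulrA -exprMn mulvV expr1n mulr1.
apply/polyP=> i; rewrite coefC; case: i => [//|i] /=.
have := pr (d + i.+1)%N; rewrite coefXnM ltnNge leq_addr addKn /= => ->.
rewrite coef_sum big1 // => j _; rewrite coefZ coefXn.
by rewrite (_ : _ == _ = false) ?mulr0 //; apply/eqP; have := ltn_ord j; lia.
Qed.

Section RegularRepresentation.

Variables (gT : finGroupType) (S : {set gT}).
Hypothesis weylS : weyl_group S.
Local Notation ell := (coxeter_length S).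
Implicit Types (s t w x y z : gT).
Local Notation q := (vV - v).
Local Notation N := #|gT|.-1.

(** The size of the matrices is written as a successor so that they form a nonzero ring. *)
Lemma card_pred_succ : N.+1 = #|gT|.
Proof. by rewrite prednK // -cardsT (cardG_gt0 [group of [set: gT]]). Qed.

Definition elt_ord w : 'I_N.+1 := cast_ord (esym card_pred_succ) (enum_rank w).
Definition ord_elt (i : 'I_N.+1) : gT := enum_val (cast_ord card_pred_succ i).

Lemma elt_ordK : cancel elt_ord ord_elt.
Proof. by move=> w; rewrite /ord_elt cast_ordKV enum_rankK. Qed.

Lemma ord_eltK : cancel ord_elt elt_ord.
Proof. by move=> i; rewrite /elt_ord enum_valK cast_ordK. Qed.

Definition ecol w : 'cV[laurent]_N.+1 := delta_mx (elt_ord w) 0.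

Lemma ecolE w x : ecol w (elt_ord x) 0 = (x == w)%:R.
Proof. by rewrite mxE eqxx andbT (inj_eq (can_inj elt_ordK)). Qed.

Lemma ecol_ext (A B : 'M[laurent]_N.+1) :
  (forall w, A *m ecol w = B *m ecol w) -> A = B.
Proof.
move=> AB; apply/matrixP=> i j; rewrite -(ord_eltK j).
by have /colP/(_ i) := AB (ord_elt j); rewrite -!colE !mxE.
Qed.

Definition ecol_map (F : gT -> 'cV[laurent]_N.+1) : 'M[laurent]_N.+1 :=
  \matrix_(i, j) F (ord_elt j) i 0.

Lemma ecol_mapE F w : ecol_map F *m ecol w = F w.
Proof. by apply/colP=> i; rewrite -colE !mxE elt_ordK. Qed.

(** The expected products of H_s with H_w on the left and on the right, prescribed on formal basis
    vectors; the boolean factor adds the quadratic term when [s] shortens [w]. *)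
Definition left_mx s :=
  ecol_map (fun w => ecol (s * w)%g + ((ell (s * w)%g < ell w)%N%:R * q) *: ecol w).

Definition right_mx s :=
  ecol_map (fun w => ecol (w * s)%g + ((ell (w * s)%g < ell w)%N%:R * q) *: ecol w).

Lemma left_right_mxC s t : s \in S -> t \in S ->
  left_mx s *m right_mx t = right_mx t *m left_mx s.
Proof.
move=> sS tS; apply: ecol_ext => w; rewrite -!mulmxA !ecol_mapE.
rewrite !mulmxDr -!scalemxAr !ecol_mapE !mulgA.
(* If [s * w = w * t] both expansions coincide; otherwise [s] and [t] do not affect each other's
   descents. *)
have [-> //|sw_wt] := eqVneq (s * w)%g (w * t)%g.
rewrite (weyl_descent_mulr weylS) // (weyl_descent_mull weylS) //.
rewrite !scalerDr !scalerA -!addrA; congr (_ + _); rewrite addrCA.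
by rewrite [X in X *: ecol w]mulrC.
Qed.

Lemma left_mx_sqr s : s \in S -> left_mx s ^+ 2 = 1 + q *: left_mx s.
Proof.
move=> sS; apply: ecol_ext => w.
rewrite expr2 -[LHS]mulmxA mulmxDl -scalemxAl mul1mx !ecol_mapE.
rewrite mulmxDr -scalemxAr !ecol_mapE (weyl_mulKl weylS) //.
rewrite (weyl_length_lt_mull weylS) // -addrA; congr (_ + _).
rewrite !scalerDr !scalerA addrA -scalerDl.
by congr (_ *: _ + _ *: _); case: ltnP => _ /=; ring.
Qed.

(** Up to the order of [s * t] every letter lengthens the word, so no quadratic term appears. *)
Lemma alternating_left_mx s t m : s \in S -> t \in S -> (m <= #[s * t]%g)%N ->
  alternating_prod (left_mx s) (left_mx t) m *m ecol 1%g =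
  ecol (alternating_word s t m).
Proof.
elim: m s t => [|m IH] s t sS tS le_m.
  by rewrite /alternating_prod big_ord0 mul1mx.
have altS (a b : 'M[laurent]_N.+1) :
    alternating_prod a b m.+1 = a * alternating_prod b a m.
  rewrite /alternating_prod big_ord_recl; congr (_ * _).
  by apply: eq_bigr => i _ /=; rewrite if_neg.
have le_m' : (m < #[t * s]%g)%N by rewrite -orderV invMg !(weyl_simpleV weylS).
rewrite altS -[LHS]mulmxA IH ?(ltnW le_m') // ecol_mapE.
rewrite -[(s * _)%g]/(alternating_word s t m.+1).
rewrite !(alternating_word_length weylS) // ?(ltnW le_m') //.
by rewrite ltnNge leqnSn mul0r scale0r addr0.
Qed.

(* The right multiplications commute with the left ones and carry [ecol 1] to
   every [ecol w]. *)
Lemma commute_right_mx_ext (A B : 'M[laurent]_N.+1) :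
    (forall t, t \in S -> A *m right_mx t = right_mx t *m A) ->
    (forall t, t \in S -> B *m right_mx t = right_mx t *m B) ->
  A *m ecol 1%g = B *m ecol 1%g -> A = B.
Proof.
move=> AR BR AB1; apply: ecol_ext => w.
have [k] := ubnP (ell w); elim: k w => // k IH w le_k.
have [->//|w1] := eqVneq w 1%g.
have [s sS lt_sw] : exists2 s, s \in S & (ell (w * s)%g < ell w)%N.
  have [|s sS] := weyl_left_descent weylS (w := w^-1%g); first by rewrite invg_eq1.
  rewrite -{1}(weyl_simpleV weylS sS) -invMg !(weyl_lengthV weylS).
  by exists s.
have wE : ecol w = right_mx s *m ecol (w * s)%g.
  rewrite ecol_mapE (weyl_mulKr weylS) // (weyl_length_lt_mulr weylS) // in lt_sw *.
  by rewrite lt_sw mul0r scale0r addr0.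
by rewrite wE !mulmxA AR // BR // -!mulmxA IH // (leq_trans lt_sw).
Qed.

(** Both sides of a braid relation commute with right multiplications, so it suffices to compare
    them at [ecol 1], where they give the two equal alternating words. *)
Lemma left_mx_relations : hecke_relations S left_mx.
Proof.
split=> [s|s t sS tS _]; first exact: left_mx_sqr.
have alt_comm a b u m : a \in S -> b \in S -> u \in S ->
    alternating_prod (left_mx a) (left_mx b) m *m right_mx u =
    right_mx u *m alternating_prod (left_mx a) (left_mx b) m.
  move=> aS bS uS; rewrite /alternating_prod.
  elim/big_ind: _ => [|A B AC BC|i _]; first by rewrite mulmx1 mul1mx.
    by rewrite -[LHS]mulmxA BC mulmxA AC -[LHS]mulmxA.
  by case: odd; apply: left_right_mxC.
apply: commute_right_mx_ext => [u uS|u uS|]; try exact: alt_comm.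
rewrite !alternating_left_mx //; first last.
  by rewrite -orderV invMg !(weyl_simpleV weylS).
by rewrite (alternating_word_swap weylS) // expg_order mul1g.
Qed.

End RegularRepresentation.

(** * The standard basis *)

Section SubalgebraType.

Variables (A : comNzRingType) (H : algType A) (V : subalgClosed H).

(** A subalgebra as an algebra of its own, so that it can be a target of the universal property. *)
Record subalg_of : predArgType :=
  SubalgOf { subalg_val :> H; _ : subalg_val \in V }.

HB.instance Definition _ := [isSub for subalg_val].
HB.instance Definition _ := [Choice of subalg_of by <:].
HB.instance Definition _ := [SubChoice_isSubAlgebra of subalg_of by <:].

Definition subalg_incl (x : subalg_of) : H := \val x.
HB.instance Definition _ :=
  GRing.RMorphism.copy subalg_incl (\val : subalg_of -> H).
HB.instance Definition _ := GRing.Linear.copy subalg_incl (\val : subalg_of -> H).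

End SubalgebraType.

(** The universal map to [V], followed by the inclusion, fixes the generators, so uniqueness makes
    it the identity. *)
Lemma hecke_subalg_full (gT : finGroupType) (S : {set gT}) (H : algType laurent)
    (Hb : gT -> H) (V : subalgClosed H) :
  hecke_algebra S Hb -> (forall s, s \in S -> Hb s \in V) -> forall h, h \in V.
Proof.
move=> [[sq br] univ _] HbV h.
pose valV : {lrmorphism subalg_of V -> H} := @subalg_incl _ _ V.
(* The default 0 can occur only outside [S]. *)
pose f s : subalg_of V := insubd 0 (Hb s).
have fE s : s \in S -> valV (f s) = Hb s.
  by move=> sS; rewrite /valV /= /subalg_incl insubdK // HbV.
have val_alt a b m :
    valV (alternating_prod a b m) = alternating_prod (valV a) (valV b) m.
  by rewrite /alternating_prod rmorph_prod; apply: eq_bigr => i _; case: odd.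
have [|phi [phiE _]] := univ (subalg_of V) f.
  split=> [s sS|s t sS tS st]; apply: (val_inj : injective valV).
    rewrite linearD linearZ /= rmorphXn rmorph1 fE //.
    by have := sq s sS; rewrite -(fE s sS).
  by rewrite !val_alt !fE //; apply: br.
have [psi [_ psiE]] := univ H Hb (conj sq br).
pose vphi : {lrmorphism H -> H} := valV \o phi.
suff <- : vphi h = h by apply: valP.
rewrite (psiE vphi) => [|s sS]; last by rewrite /= phiE ?fE.
by rewrite -(psiE idfun).
Qed.

Section HeckeBasis.

Variables (gT : finGroupType) (S : {set gT}) (H : algType laurent).
Variable Hb : gT -> H.
Hypotheses (weylS : weyl_group S) (heckeH : hecke_algebra S Hb).
Local Notation ell := (coxeter_length S).
Implicit Types (s t w x y z : gT) (g h : H).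
Local Notation q := (vV - v).

(** When lengths add, concatenated reduced words are reduced. *)
Lemma Hb_mul x y : ell (x * y)%g = (ell x + ell y)%N -> Hb (x * y)%g = Hb x * Hb y.
Proof.
have [r rE] := reduced_exists (weyl_gen weylS) x.
have [u uE] := reduced_exists (weyl_gen weylS) y => lxy.
rewrite (hecke_std heckeH rE) (hecke_std heckeH uE) -big_cat.
apply: (hecke_std heckeH); case: rE uE => [rS rp szr] [uS up szu].
by split; rewrite ?all_cat ?rS ?big_cat /= ?rp ?up ?size_cat ?szr ?szu.
Qed.

Lemma Hb1 : Hb 1%g = 1.
Proof.
rewrite (@hecke_std _ _ _ _ heckeH _ [::]) ?big_nil //.
by split; rewrite ?big_nil ?coxeter_length1.
Qed.

Lemma Hb_sqr s : s \in S -> Hb s * Hb s = 1 + q *: Hb s.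
Proof. by case: heckeH => [[sq _] _ _]; apply: sq. Qed.

Lemma Hb_mull s w : s \in S ->
  Hb s * Hb w = Hb (s * w)%g + ((ell (s * w)%g < ell w)%N%:R * q) *: Hb w.
Proof.
move=> sS; have l1 := weyl_simple_length weylS sS.
have lw := weyl_length_mull weylS w sS; case: ltnP lw => [lt_sw lw|_ lw].
  have HbE : Hb w = Hb s * Hb (s * w)%g.
    rewrite -Hb_mul (weyl_mulKl weylS) // l1 lw add1n prednK //.
    by apply: leq_trans lt_sw.
  rewrite {1}HbE mulrA Hb_sqr // mulrDl mul1r -scalerAl -HbE.
  by rewrite mul1r.
by rewrite Hb_mul ?l1 // mul0r scale0r addr0.
Qed.

Lemma Hb_mulr s w : s \in S ->
  Hb w * Hb s = Hb (w * s)%g + ((ell (w * s)%g < ell w)%N%:R * q) *: Hb w.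
Proof.
move=> sS; have l1 := weyl_simple_length weylS sS.
have lw := weyl_length_mulr weylS w sS; case: ltnP lw => [lt_sw lw|_ lw].
  have HbE : Hb w = Hb (w * s)%g * Hb s.
    rewrite -Hb_mul (weyl_mulKr weylS) // l1 lw addn1 prednK //.
    by apply: leq_trans lt_sw.
  rewrite {1}HbE -mulrA Hb_sqr // mulrDr mulr1 -scalerAr -HbE.
  by rewrite mul1r.
by rewrite Hb_mul ?l1 ?addn1 // mul0r scale0r addr0.
Qed.

(** The span of the [Hb x] is stable under left multiplication by each [Hb s], hence by each [Hb w];
    so it is a subalgebra containing the generators. *)
Lemma Hb_span h : exists c : gT -> laurent, h = \sum_x c x *: Hb x.
Proof.
pose V : {pred H} := fun h => `[< exists c : gT -> laurent, h = \sum_x c x *: Hb x >].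
have Vlin a : {in V &, forall g h, a *: g + h \in V}.
  move=> _ _ /asboolP[c ->] /asboolP[d ->]; apply/asboolP.
  exists (fun x => a * c x + d x); rewrite scaler_sumr -big_split /=.
  by apply: eq_bigr => x _; rewrite scalerDl scalerA.
have V0 : 0 \in V.
  by apply/asboolP; exists (fun _ => 0); rewrite big1 // => x _; rewrite scale0r.
have VHb w : Hb w \in V.
  apply/asboolP; exists (fun x => (x == w)%:R); rewrite (bigD1 w) //= eqxx scale1r.
  by rewrite big1 ?addr0 // => x /negPf->; rewrite scale0r.
have Vsum (F : gT -> H) : (forall x, F x \in V) -> \sum_x F x \in V.
  move=> FV; elim/big_ind: _ => // g k gV kV.
  by rewrite -[g]scale1r Vlin.
have VZ a g : g \in V -> a *: g \in V by move=> gV; rewrite -[_ *: _]addr0 Vlin.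
have Vs s g : s \in S -> g \in V -> Hb s * g \in V.
  move=> sS /asboolP[c ->]; rewrite mulr_sumr; apply: (Vsum _) => x.
  rewrite -scalerAr VZ // Hb_mull // addrC Vlin //.
have Vw w g : g \in V -> Hb w * g \in V.
  have [r rE] := reduced_exists (weyl_gen weylS) w.
  rewrite (hecke_std heckeH rE); case: rE => [rS _ _] gV.
  elim: r rS => [|s r IH /= /andP[sS rS]]; first by rewrite big_nil mul1r.
  by rewrite big_cons -mulrA Vs // IH.
have Vsub : subalg_closed V.
  split=> [||_ g /asboolP[c ->] gV]; rewrite -?Hb1 //.
  rewrite mulr_suml; apply: (Vsum _) => x.
  by rewrite -scalerAl VZ // Vw.
pose V' : subalgClosed H := HB.pack V (GRing.isSubalgClosed.Build _ H V Vsub).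
by apply/asboolP; apply: (hecke_subalg_full (V := V') heckeH) => s _; apply: VHb.
Qed.

Definition hecke_rep : {lrmorphism H -> 'M[laurent]_(#|gT|.-1.+1)} :=
  projT1 (cid (hecke_univ heckeH (left_mx_relations weylS))).

Lemma hecke_repE s : s \in S -> hecke_rep (Hb s) = left_mx S s.
Proof. by move=> sS; rewrite /hecke_rep; case: cid => phi [/= phiE _]; apply: phiE. Qed.

Lemma hecke_repM g h : hecke_rep (g * h) = hecke_rep g *m hecke_rep h.
Proof. exact: rmorphM. Qed.

(** The column [ecol 1] stands for H_e. Defining coordinates through its image, rather than through
    an expansion, makes them linear from the start and yields the independence of the H_w in
    [HcoefE]. *)
Definition Hcoef h x : laurent := (hecke_rep h *m ecol 1%g) (elt_ord x) 0.

Lemma hecke_rep_ecol w : hecke_rep (Hb w) *m ecol 1%g = ecol w.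
Proof.
have [k] := ubnP (ell w); elim: k w => // k IH w le_k.
have [->|w1] := eqVneq w 1%g; first by rewrite Hb1 rmorph1 mul1mx.
have [s sS lt_sw] := weyl_left_descent weylS w1.
have := Hb_mull (s * w)%g sS; rewrite (weyl_mulKl weylS) //.
have nlt : (ell w < ell (s * w)%g)%N = false by rewrite ltnNge (ltnW lt_sw).
rewrite nlt mul0r scale0r addr0 => <-.
rewrite hecke_repM -mulmxA IH ?(leq_trans lt_sw) // hecke_repE // ecol_mapE.
by rewrite (weyl_mulKl weylS) // nlt mul0r scale0r addr0.
Qed.

Lemma HcoefE (c : gT -> laurent) x : Hcoef (\sum_y c y *: Hb y) x = c x.
Proof.
rewrite /Hcoef rmorph_sum mulmx_suml summxE (bigD1 x) //=.
rewrite linearZ -scalemxAl hecke_rep_ecol mxE ecolE eqxx mulr1.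
rewrite big1 ?addr0 // => y yx.
by rewrite linearZ -scalemxAl hecke_rep_ecol mxE ecolE eq_sym (negPf yx) mulr0.
Qed.

Lemma Hcoef_sum h : h = \sum_x Hcoef h x *: Hb x.
Proof.
by have [c ->] := Hb_span h; apply: eq_bigr => x _; rewrite HcoefE.
Qed.

Lemma Hcoef_ext g h : (forall x, Hcoef g x = Hcoef h x) -> g = h.
Proof.
by move=> gh; rewrite [g]Hcoef_sum [h]Hcoef_sum; apply: eq_bigr => x _; rewrite gh.
Qed.

Lemma Hcoef_linear a g h x : Hcoef (a *: g + h) x = a * Hcoef g x + Hcoef h x.
Proof.
by rewrite /Hcoef linearP mulmxDl -scalemxAl !mxE.
Qed.

End HeckeBasis.

(** * The Kazhdan-Lusztig basis *)

Section KazhdanLusztig.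

Variables (gT : finGroupType) (S : {set gT}) (H : algType laurent).
Variables (Hb : gT -> H) (bar : {rmorphism H -> H}) (KL : gT -> H).
Hypotheses (weylS : weyl_group S) (heckeH : hecke_algebra S Hb).
Hypotheses (barH : bar_involution S Hb bar) (KLH : KL_basis Hb bar KL).
Local Notation ell := (coxeter_length S).
Local Notation coef := (Hcoef weylS heckeH).
Implicit Types (s t w x y z u : gT) (g h : H).
Local Notation q := (vV - v).

Lemma HcoefZ a h x : coef (a *: h) x = a * coef h x.
Proof. by rewrite /Hcoef linearZ -scalemxAl mxE. Qed.

Lemma HcoefD g h x : coef (g + h) x = coef g x + coef h x.
Proof. by rewrite -[g]scale1r Hcoef_linear HcoefZ. Qed.

Lemma HcoefB g h x : coef (g - h) x = coef g x - coef h x.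
Proof. by rewrite HcoefD -scaleN1r HcoefZ mulN1r. Qed.

Lemma Hcoef0 x : coef 0 x = 0.
Proof. by rewrite -[0](scale0r 0) HcoefZ mul0r. Qed.

Lemma Hcoef_suml (I : finType) (P : pred I) (F : I -> H) x :
  coef (\sum_(i | P i) F i) x = \sum_(i | P i) coef (F i) x.
Proof.
by elim/big_rec2: _ => [|i a g _ <-]; rewrite ?Hcoef0 // HcoefD.
Qed.

Lemma Hcoef_Hb w x : coef (Hb w) x = (x == w)%:R.
Proof. by rewrite /Hcoef hecke_rep_ecol ecolE. Qed.

Lemma Hcoef_mull s h x : s \in S ->
  coef (Hb s * h) x = coef h (s * x)%g + (ell (s * x)%g < ell x)%N%:R * q * coef h x.
Proof.
move=> sS; rewrite {1}[h](Hcoef_sum weylS heckeH) mulr_sumr Hcoef_suml.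
under eq_bigr => y _ do rewrite -scalerAr HcoefZ (Hb_mull weylS heckeH) // HcoefD
  HcoefZ !Hcoef_Hb mulrDr.
rewrite big_split /=; congr (_ + _).
  rewrite (bigD1 (s * x)%g) //= (weyl_mulKl weylS) // eqxx mulr1 big1 ?addr0 // => y ne.
  case: eqP => [xE|]; rewrite ?mulr0 //.
  by rewrite xE (weyl_mulKl weylS) ?eqxx in ne.
rewrite (bigD1 x) //= eqxx mulr1 mulrC big1 ?addr0 // => y yx.
by rewrite eq_sym (negPf yx) !mulr0.
Qed.

Lemma Hcoef_mulr s h x : s \in S ->
  coef (h * Hb s) x = coef h (x * s)%g + (ell (x * s)%g < ell x)%N%:R * q * coef h x.
Proof.
move=> sS; rewrite {1}[h](Hcoef_sum weylS heckeH) mulr_suml Hcoef_suml.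
under eq_bigr => y _ do rewrite -scalerAl HcoefZ (Hb_mulr weylS heckeH) // HcoefD
  HcoefZ !Hcoef_Hb mulrDr.
rewrite big_split /=; congr (_ + _).
  rewrite (bigD1 (x * s)%g) //= (weyl_mulKr weylS) // eqxx mulr1 big1 ?addr0 // => y ne.
  case: eqP => [xE|]; rewrite ?mulr0 //.
  by rewrite xE (weyl_mulKr weylS) ?eqxx in ne.
rewrite (bigD1 x) //= eqxx mulr1 mulrC big1 ?addr0 // => y yx.
by rewrite eq_sym (negPf yx) !mulr0.
Qed.

(** The filtration by length, which serves in place of the Bruhat order. *)
Definition lower k h := forall x, (k <= ell x)%N -> coef h x = 0.

Lemma lowerW k m h : (k <= m)%N -> lower k h -> lower m h.
Proof. by move=> le_km low x le_m; apply: low; apply: leq_trans le_m. Qed.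

Lemma lowerD k g h : lower k g -> lower k h -> lower k (g + h).
Proof. by move=> lg lh x le_k; rewrite HcoefD lg ?lh ?addr0. Qed.

Lemma lowerZ k a h : lower k h -> lower k (a *: h).
Proof. by move=> lh x le_k; rewrite HcoefZ lh ?mulr0. Qed.

Lemma lowerB k g h : lower k g -> lower k h -> lower k (g - h).
Proof. by move=> lg lh; rewrite -scaleN1r; apply/lowerD/lowerZ. Qed.

Lemma lower_sum k (I : finType) (P : pred I) (F : I -> H) :
  (forall i, P i -> lower k (F i)) -> lower k (\sum_(i | P i) F i).
Proof. by move=> lF x le_k; rewrite Hcoef_suml big1 // => i /lF->. Qed.

Lemma lower_Hb w : lower (ell w).+1 (Hb w).
Proof. by move=> x; rewrite Hcoef_Hb; case: eqP => // ->; rewrite ltnn. Qed.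

Lemma lower_eq0 h : lower 0 h -> h = 0.
Proof.
by move=> lh; apply: (Hcoef_ext (weylS := weylS) (heckeH := heckeH)) => x;
  rewrite Hcoef0 lh.
Qed.

Lemma lower_mul_simple s k h : s \in S -> lower k h -> lower k.+1 (Hb s * h).
Proof.
move=> sS lh x lt_k; have le_k : (k <= ell (s * x)%g)%N.
  have := weyl_length_mull weylS x sS; case: ltnP => _ ->; last exact/leqW/ltnW.
  by rewrite -ltnS prednK // (leq_trans _ lt_k).
by rewrite Hcoef_mull // !lh ?mulr0 ?addr0 // ltnW.
Qed.

Lemma lower_mul_Hb w k h : lower k h -> lower (ell w + k) (Hb w * h).
Proof.
have [r rE] := reduced_exists (weyl_gen weylS) w => lh.
rewrite (hecke_std heckeH rE); case: rE => [rS _ <-].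
elim: r rS => [|s r IH /= /andP[sS rS]]; first by rewrite big_nil mul1r.
by rewrite big_cons -mulrA; apply: lower_mul_simple => //; apply: IH.
Qed.

Lemma bar_evalv p : bar (evalv p)%:A = (evalvV p)%:A.
Proof.
case: barH => _ barv _; rewrite /evalvV; elim/poly_ind: p => [|p c IH].
  by rewrite /evalv !rmorph0 !horner0 scale0r rmorph0.
have algM (a b : laurent) : (a * b)%:A = a%:A * b%:A :> H by rewrite mulr_algl scalerA.
rewrite evalvD evalvM evalvX evalvC rmorphD rmorphM /= map_polyX map_polyC !hornerE.
rewrite !scalerDl !algM rmorphD rmorphM /= barv IH; congr (_ + _).
by rewrite !scaler_int rmorph_int.
Qed.

(** By the quadratic relation the right-hand side is the inverse of [Hb s]. *)
Lemma bar_simple s : s \in S -> bar (Hb s) = Hb s - q%:A.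
Proof.
move=> sS; case: barH => _ _ /(_ s sS)[_ barK].
have HsK : Hb s * (Hb s - q%:A) = 1.
  by rewrite mulrBr (Hb_sqr heckeH) // mulr_algr addrK.
by have := congr1 ( *%R (bar (Hb s))) HsK; rewrite mulrA barK mul1r mulr1.
Qed.

(** Induction along a left descent [s]: the error for [w] is [Hb s] times the error for [s * w],
    minus [q] times the bar of [Hb (s * w)]. *)
Lemma lower_barB w : lower (ell w) (bar (Hb w) - Hb w).
Proof.
have [k] := ubnP (ell w); elim: k w => // k IH w le_k.
have [->|w1] := eqVneq w 1%g.
  by rewrite (Hb1 heckeH) rmorph1 subrr => x _; rewrite Hcoef0.
have [s sS lt_sw] := weyl_left_descent weylS w1.
have lw := weyl_length_mull weylS w sS; rewrite lt_sw in lw.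
have lwE : (ell (s * w)%g).+1 = ell w by rewrite lw prednK // (leq_trans _ lt_sw).
have HwE : Hb w = Hb s * Hb (s * w)%g.
  rewrite -(Hb_mul weylS heckeH) (weyl_mulKl weylS) //.
  by rewrite (weyl_simple_length weylS sS) add1n lwE.
rewrite HwE rmorphM bar_simple // -lwE.
have lb := IH _ (leq_trans lt_sw le_k).
have -> : (Hb s - q%:A) * bar (Hb (s * w)%g) - Hb s * Hb (s * w)%g =
    Hb s * (bar (Hb (s * w)%g) - Hb (s * w)%g)
    - q *: (bar (Hb (s * w)%g) - Hb (s * w)%g) - q *: Hb (s * w)%g.
  by rewrite mulrBl mulr_algl -[RHS]addrA -opprD -scalerDr subrK mulrBr addrAC.
apply/lowerB/lowerZ/lower_Hb; apply: lowerB; first exact: lower_mul_simple.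
exact/lowerZ/(lowerW (leqnSn _)).
Qed.

(* Modulo lower terms the bar involution fixes each standard basis element, so
   a top coefficient of a bar-invariant element is itself invariant under the
   exchange of v and v^-1. *)
Lemma top_coef_constant (P : gT -> {poly int}) h x :
    (forall y, coef h y = evalv (P y)) -> bar h = h ->
    (forall y, P y != 0 -> (ell y <= ell x)%N) ->
  P x = ((P x)`_0)%:P.
Proof.
move=> hE bar_h topx; apply: evalv_symmetric; rewrite -hE -{1}bar_h.
rewrite [in LHS](Hcoef_sum weylS heckeH h) rmorph_sum Hcoef_suml (bigD1 x) //=.
have termE y : coef (bar (coef h y *: Hb y)) x =
    evalvV (P y) * (coef (bar (Hb y) - Hb y) x + (x == y)%:R).
  rewrite -Hcoef_Hb -HcoefD subrK hE -mulr_algl rmorphM bar_evalv mulr_algl.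
  by rewrite HcoefZ.
rewrite termE eqxx lower_barB // add0r mulr1 big1 ?addr0 // => y yx.
rewrite termE eq_sym (negPf yx) addr0.
have [->|/topx le_yx] := eqVneq (P y) 0.
  by rewrite /evalvV rmorph0 horner0 mul0r.
by rewrite lower_barB ?mulr0.
Qed.

Lemma KL_poly w : exists p : gT -> {poly int},
  forall x, coef (KL w) x = evalv ((x == w)%:R + 'X * p x).
Proof.
have [_ [p pE]] := KLH w; exists p => x.
rewrite pE HcoefD Hcoef_Hb HcoefE evalvD evalvM evalvX; congr (_ + _).
by case: eqP => _; rewrite /evalv ?rmorph1 ?rmorph0 ?hornerC ?horner0.
Qed.

Lemma exists_max_length (P : pred gT) x : P x ->
  exists2 y, P y & forall z, P z -> (ell z <= ell y)%N.
Proof. by move=> Px; case: (arg_maxnP ell Px) => y Py maxy; exists y. Qed.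

Lemma evalv_eq0 p : (evalv p == 0) = (p == 0).
Proof. by rewrite -(inj_eq evalv_inj) [evalv 0]/evalv rmorph0 horner0. Qed.

(** A coefficient beyond which no longer one is nonzero is constant, by [top_coef_constant], and its
    constant term is 1 at [w] and 0 elsewhere. So [w] is the only longest element of the support. *)
Lemma KL_lower w : lower (ell w) (KL w - Hb w).
Proof.
have [p pE] := KL_poly w; pose P x := (x == w)%:R + 'X * p x.
have P0 x : (P x)`_0 = (x == w)%:R.
  by rewrite /P coefD coefXM addr0; case: eqP => _; rewrite ?coef1 ?coef0.
have topP x : (forall y, P y != 0 -> (ell y <= ell x)%N) -> P x = (x == w)%:R.
  move=> maxx; rewrite (top_coef_constant (P := P) pE (proj1 (KLH w)) maxx) P0.
  by case: eqP.
have Pw : P w != 0.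
  by apply/eqP=> Pw; have := P0 w; rewrite Pw eqxx coef0 => /eqP.
have [y Py maxy] := @exists_max_length (fun x => P x != 0) w Pw.
have yw : y = w.
  by apply/eqP; apply: contraNT Py => yw; rewrite topP // (negPf yw).
rewrite {}yw in Py maxy => x le_wx; rewrite HcoefB Hcoef_Hb pE -/(P x).
rewrite topP => [|z /maxy le_zw]; last exact: leq_trans le_wx.
by case: eqP => _; rewrite ?rmorph1 /evalv ?rmorph1 ?rmorph0 ?hornerC ?horner0 subrr.
Qed.

Lemma KL_coef_top w x : (ell w <= ell x)%N -> coef (KL w) x = (x == w)%:R.
Proof.
by move=> /KL_lower; rewrite HcoefB Hcoef_Hb => /eqP; rewrite subr_eq0 => /eqP.
Qed.

Lemma KL_span h : exists c : gT -> laurent, h = \sum_x c x *: KL x.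
Proof.
suff spanK k : forall g, lower k g -> exists c : gT -> laurent, g = \sum_x c x *: KL x.
  apply: (spanK (\max_x ell x).+1) => x; rewrite ltnNge.
  by rewrite (leq_bigmax (F := fun x => ell x)).
elim: k => [|k IH] g lg.
  by exists (fun _ => 0); rewrite (lower_eq0 lg) big1 // => x _; rewrite scale0r.
(* Subtracting all terms at once is harmless: those with [x] shorter than [k] only affect lengths
   below [k]. *)
have [|c cE] := IH (g - \sum_x coef g x *: KL x).
  move=> x le_kx; rewrite HcoefB Hcoef_suml (bigD1 x) //= HcoefZ KL_coef_top //.
  rewrite eqxx mulr1 big1 ?addr0 ?subrr // => y yx; rewrite HcoefZ.
  have [le_y|lt_y] := leqP (ell y) k; last by rewrite lg ?mul0r.
  by rewrite KL_coef_top ?(leq_trans le_y) // eq_sym (negPf yx) mulr0.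
exists (fun x => c x + coef g x); under eq_bigr do rewrite scalerDl.
by rewrite big_split /= -cE subrK.
Qed.

Lemma KL_right_descent w s : s \in S -> (ell (w * s)%g < ell w)%N ->
  KL w * Hb s = vV *: KL w.
Proof.
move=> sS lt_ws; have [p pE] := KL_poly w.
pose P x := (x == w)%:R + 'X * p x.
pose d x := (ell (x * s)%g < ell x)%N.
have dV x : d (x * s)%g = ~~ d x.
  by rewrite /d (weyl_mulKr weylS) // (weyl_length_lt_mulr weylS).
have Pnd x : ~~ d x -> P x = 'X * p x.
  by rewrite /P; case: eqP => [->|_ _]; rewrite ?add0r // /d lt_ws.
(* Where [s] is not a descent of [x], [x] differs from [w] and [P x] is divisible by ['X]; this
   absorbs the factor [vV] and keeps the coefficients of [h] in Z[v]. *)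
pose Q x := if d x then 'X * (p (x * s)%g - P x) else P (x * s)%g - p x.
pose h := KL w * Hb s - vV *: KL w.
have hE x : coef h x = evalv (Q x).
  rewrite HcoefB HcoefZ Hcoef_mulr // !pE -!/(P _) -/(d x) /Q.
  case: ifPn => dx /=; rewrite ?mul0r ?mul1r ?addr0.
    rewrite (Pnd (x * s)%g) ?dV ?negbK // 2!evalvM evalvX.
    by rewrite [evalv (_ - _)]evalvD evalvN; ring.
  rewrite (Pnd x) // evalvM evalvX mulrA [vV * v]mulrC mulvV mul1r.
  by rewrite [evalv (_ - _)]evalvD evalvN.
have QV x : d x -> Q x = - 'X * Q (x * s)%g.
  by move=> dx; rewrite /Q dV dx /= (weyl_mulKr weylS) // mulNr -mulrN opprB.
(* Both [KL w] and [Hb s - vV%:A] are fixed by [bar]. *)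
have bar_h : bar h = h.
  have [_ barv _] := barH; have barK := proj1 (KLH w).
  have hE' : h = KL w * (Hb s - vV%:A) by rewrite mulrBr mulr_algr.
  have barvV : bar vV%:A = v%:A.
    have vvV : vV%:A * v%:A = 1 :> H by rewrite mulr_algl scalerA mulrC mulvV scale1r.
    have : bar vV%:A * vV%:A = 1 by rewrite -{2}barv -rmorphM vvV rmorph1.
    by move/(congr1 ( *%R^~ v%:A)) => /=; rewrite -mulrA vvV mulr1 mul1r.
  rewrite hE' rmorphM rmorphB barK bar_simple // barvV; congr (_ * _).
  by rewrite -addrA -opprD -scalerDl subrK.
suff Q0 x : Q x = 0.
  apply/eqP; rewrite -subr_eq0 -/h; apply/eqP.
  apply: (Hcoef_ext (weylS := weylS) (heckeH := heckeH)) => x.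
  by rewrite hE Q0 Hcoef0; apply/eqP; rewrite evalv_eq0.
apply/eqP; apply/negPn/negP => /(@exists_max_length (fun x => Q x != 0))[y Qy maxy].
(* At a descent [Q y] is both constant and divisible by ['X]; otherwise [y * s] is longer with a
   nonzero coefficient. *)
have [dy|dy] := boolP (d y).
  case/eqP: Qy; rewrite (top_coef_constant hE bar_h maxy) QV // mulNr coefN.
  by rewrite coefXM oppr0.
have := maxy (y * s)%g; rewrite QV ?dV // (weyl_mulKr weylS) //.
rewrite mulf_neq0 //; last first.
  by rewrite oppr_eq0 polyX_eq0.
by move=> /(_ isT); rewrite leqNgt (weyl_length_lt_mulr weylS) // -/(d y) dy.
Qed.

(** If [x * s] were longer, [h] would have no coefficient there, while [h * Hb s] has [coef h x]. *)
Lemma top_right_descent h s x : s \in S -> h * Hb s = vV *: h -> coef h x != 0 ->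
    (forall y, coef h y != 0 -> (ell y <= ell x)%N) ->
  (ell (x * s)%g < ell x)%N.
Proof.
move=> sS hs hx maxx; apply: contraNT hx.
rewrite -(weyl_length_lt_mulr weylS) // => lt_x.
have hxs : coef h (x * s)%g = 0.
  by apply/eqP; apply: contraLR lt_x => /maxx; rewrite -leqNgt.
have := Hcoef_mulr h (x * s)%g sS; rewrite hs HcoefZ hxs !mulr0 addr0.
by rewrite (weyl_mulKr weylS) // => <-.
Qed.

(** Remove the terms with descent [s], which satisfy the same equation by [KL_right_descent]. The
    longest index left is at the top of the standard support of the remainder [h], so
    [top_right_descent] gives a contradiction. *)
Lemma KL_coef_right_descent (c : gT -> laurent) s u : s \in S ->
    (\sum_x c x *: KL x) * Hb s = vV *: \sum_x c x *: KL x -> c u != 0 ->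
  (ell (u * s)%g < ell u)%N.
Proof.
move=> sS hs cu; apply: contraT => nd_u.
pose d x := (ell (x * s)%g < ell x)%N.
pose h := \sum_(x | ~~ d x) c x *: KL x.
have hsE : h * Hb s = vV *: h.
  have hE : h = \sum_x c x *: KL x - \sum_(x | d x) c x *: KL x.
    by rewrite [X in X - _](bigID d) /= addrAC subrr add0r.
  rewrite hE mulrBl hs scalerBr; congr (_ - _); rewrite mulr_suml scaler_sumr.
  apply: eq_bigr => x dx; rewrite -scalerAl KL_right_descent //.
  by rewrite !scalerA mulrC.
have [y /andP[dy cy] maxy] := @exists_max_length (fun x => ~~ d x && (c x != 0)) u
  (introT andP (conj nd_u cu)).
(* From the length of [y] on, the standard and the KL coefficients of [h] agree. *)
have top z : (ell y <= ell z)%N -> coef h z = if d z then 0 else c z.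
  move=> le_yz; rewrite Hcoef_suml.
  have tE x : ~~ d x -> coef (c x *: KL x) z = c x * (z == x)%:R.
    move=> dx; rewrite HcoefZ; have [->|cx] := eqVneq (c x) 0; first by rewrite !mul0r.
    by rewrite KL_coef_top // (leq_trans (maxy _ _)) ?dx.
  rewrite (eq_bigr _ tE); case: ifPn => dz.
    by apply: big1 => x; case: eqP => [<-|]; rewrite ?dz ?mulr0.
  rewrite (bigD1 z) //= eqxx mulr1 big1 ?addr0 // => x /andP[_].
  by rewrite eq_sym => /negPf->; rewrite mulr0.
have hy : coef h y != 0 by rewrite (top y (leqnn _)) (negPf dy); exact: cy.
case/negP: (dy); apply: (top_right_descent sS hsE hy) => z.
apply: contraNT; rewrite -ltnNge => lt_yz; rewrite (top z (ltnW lt_yz)).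
case: ifPn => dz; first by rewrite eqxx.
by apply: contraTT lt_yz => cz; rewrite -leqNgt maxy ?dz.
Qed.

(** * The left ideal of the longest element of a parabolic subgroup *)

Section ParabolicIdeal.

Variables (J : {set gT}) (w0 : gT).
Hypotheses (sJS : J \subset S) (w0_longest : longest_element S <<J>>%g w0).

Lemma longest_descent s : s \in J -> (ell (w0 * s)%g < ell w0)%N.
Proof.
move=> sJ; have sS := subsetP sJS s sJ; have [w0J maxw0] := w0_longest.
have := maxw0 (w0 * s)%g; rewrite groupM ?(mem_gen sJ) // => /(_ isT).
by rewrite leqNgt (weyl_length_lt_mulr weylS) // negbK.
Qed.

(** Inversion turns the right descents of [y] into left ones, as [weyl_parabolic_length]
    requires. *)
Lemma longest_length_mul y : (forall s, s \in J -> (ell (y * s)%g < ell y)%N) ->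
  (ell (y * w0^-1)%g + ell w0 = ell y)%N.
Proof.
move=> dy; have [w0J _] := w0_longest.
rewrite -(weyl_lengthV weylS y).
rewrite -(weyl_parabolic_length weylS sJS (y := y^-1%g) (z := w0)) //.
  by rewrite -(weyl_lengthV weylS (y * _)%g) invMg invgK.
move=> s sJ; rewrite -{1}(weyl_simpleV weylS (subsetP sJS s sJ)) -invMg.
by rewrite !(weyl_lengthV weylS) dy.
Qed.

Lemma mem_left_ideal_KL h : (forall s, s \in J -> h * Hb s = vV *: h) ->
  left_ideal_gen (KL w0) h.
Proof.
suff idK k : forall g, lower k g -> (forall s, s \in J -> g * Hb s = vV *: g) ->
    left_ideal_gen (KL w0) g.
  apply: (idK (\max_x ell x).+1) => x; rewrite ltnNge.
  by rewrite (leq_bigmax (F := fun x => ell x)).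
elim: k => [|k IH] g lg gE.
  by exists 0; rewrite mul0r (lower_eq0 lg).
(* A top element [y] factors as [y * w0^-1] times [w0], so [a * KL w0] has the same terms of length
   [k] as [g]. *)
pose a := \sum_(y | ell y == k) coef g y *: Hb (y * w0^-1)%g.
have [||b bE] := IH (g - a * KL w0).
- have -> : g - a * KL w0 = (g - \sum_(y | ell y == k) coef g y *: Hb y)
      - \sum_(y | ell y == k) coef g y *: (Hb (y * w0^-1)%g * KL w0 - Hb y).
    under [X in _ = _ - X]eq_bigr do rewrite scalerBr.
    rewrite sumrB opprB addrA subrK /a mulr_suml; congr (_ - _).
    by apply: eq_bigr => y _; rewrite scalerAl.
  apply: lowerB.
    move=> x; rewrite leq_eqVlt => /predU1P[kx|lt_k].
      rewrite HcoefB Hcoef_suml (bigD1 x) ?kx //= HcoefZ Hcoef_Hb eqxx mulr1.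
      rewrite big1 ?addr0 ?subrr // => y /andP[_ yx].
      by rewrite HcoefZ Hcoef_Hb eq_sym (negPf yx) mulr0.
    rewrite HcoefB lg // Hcoef_suml big1 ?subrr // => y /eqP yk.
    rewrite HcoefZ Hcoef_Hb; case: eqP => [xy|]; last by rewrite mulr0.
    by rewrite xy yk ltnn in lt_k.
  apply: lower_sum => y /eqP yk.
  have [->|gy] := eqVneq (coef g y) 0; first by rewrite scale0r => x _; rewrite Hcoef0.
  apply: lowerZ; have lyE : (ell (y * w0^-1)%g + ell w0 = ell y)%N.
    (* An element of length [k] in the support of [g] is longest there, since [g] is
       [lower k.+1]. *)
    apply: longest_length_mul => s sJ.
    apply: (top_right_descent (subsetP sJS s sJ) (gE s sJ) gy) => z.
    by apply: contraNT; rewrite -ltnNge yk => lt_k; rewrite lg.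
  have -> : Hb (y * w0^-1)%g * KL w0 - Hb y = Hb (y * w0^-1)%g * (KL w0 - Hb w0).
    by rewrite mulrBr -(Hb_mul weylS heckeH) mulgKV ?lyE.
  by rewrite -yk -lyE; apply/lower_mul_Hb/KL_lower.
- move=> s sJ; rewrite mulrBl gE // scalerBr -mulrA.
  rewrite KL_right_descent ?longest_descent //.
    by rewrite scalerAr.
  exact: subsetP sJ.
by exists (b + a); rewrite mulrDl -bE subrK.
Qed.

(** The product [KL w * KL w0] inherits the equation for right multiplication by [Hb s] from its
    last factor. *)
Lemma KL_left_le_descent u s : KL_left_le KL w0 u -> s \in J ->
  (ell (u * s)%g < ell u)%N.
Proof.
move=> [w [c [cE cu]]] sJ; have sS := subsetP sJS s sJ.
apply: (KL_coef_right_descent sS _ cu); rewrite -cE -mulrA KL_right_descent //.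
  by rewrite scalerAr.
exact: longest_descent.
Qed.

End ParabolicIdeal.

End KazhdanLusztig.

Theorem theorem12 (gT : finGroupType) (S W' : {set gT}) (w0 : gT)
    (H : algType laurent) (Hb : gT -> H) (bar : {rmorphism H -> H})
    (KL : gT -> H) :
  weyl_group S ->
  parabolic S W' ->
  longest_element S W' w0 ->
  hecke_algebra S Hb ->
  bar_involution S Hb bar ->
  KL_basis Hb bar KL ->
  forall h : H, left_ideal_gen (KL w0) h <-> LM KL w0 h.
Proof.
move=> weylS [J sJS ->] w0_longest heckeH barH KLH h; split.
  move=> [b ->]; have [d ->] := KL_span weylS heckeH barH KLH b.
  have [c cE] := choice (fun w => KL_span weylS heckeH barH KLH (KL w * KL w0)).
  exists (fun u => \sum_w d w * c w u); split=> [u sum_u|].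
    (* A nonzero total coefficient has a nonzero summand, and its [w] witnesses the pre-order. *)
    have [w dcw] : exists w, d w * c w u != 0.
      apply/existsP; apply: contraNT sum_u; rewrite negb_exists => /forallP dc0.
      by rewrite big1 // => w _; apply/eqP; rewrite -[_ == _]negbK dc0.
    exists w, (c w); split; first exact: cE.
    by apply: contraNneq dcw => ->; rewrite mulr0.
  rewrite mulr_suml; under [RHS]eq_bigr do rewrite scaler_suml.
  rewrite exchange_big /=; apply: eq_bigr => w _.
  rewrite -scalerAl cE scaler_sumr; apply: eq_bigr => u _.
  by rewrite scalerA.
case=> c [c_le ->].
have ideal u : exists b, c u *: KL u = b * KL w0.
  (* The pre-order is known only where the coefficient is nonzero. *)
  have [->|cu] := eqVneq (c u) 0; first by exists 0; rewrite scale0r mul0r.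
  have [|b ->] := mem_left_ideal_KL weylS heckeH barH KLH sJS w0_longest (h := KL u).
    move=> s sJ; apply: (KL_right_descent weylS heckeH barH KLH).
      exact: subsetP sJ.
    exact: (KL_left_le_descent weylS heckeH barH KLH sJS w0_longest (c_le _ cu)).
  by exists (c u *: b); rewrite scalerAl.
have [b bE] := choice ideal; exists (\sum_u b u).
by rewrite mulr_suml; apply: eq_bigr => u _.
Qed.
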